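(* Let $\mathfrak n$ be a non-abelian $6$-dimensional nilpotent real Lie algebra with an abelian complex structure $J$. Then $(\mathfrak n,J)$ is holomorphically isomorphic to one and only one of the following pairs (where $\mathfrak n_1,\dots,\mathfrak n_7$ are the Lie algebras with basis $e_1,\dots,e_6$ listed in the context): \begin{enumerate} \item $(\mathfrak n_1,J)$ with $Je_1=e_2$, $Je_3=e_4$, $Je_5=e_6$; \item $(\mathfrak n_2,J_{+})$ or $(\mathfrak n_2,J_{-})$, with $J_\pm e_1=e_2$, $J_\pm e_3=\pm e_4$, $J_\pm e_5=e_6$; \item $(\mathfrak n_3,J_s)$ with $J_se_1=e_2$, $J_se_3=e_4$, $J_se_5=s\,e_5+e_6$, $s\in\mathbb R$; \item $(\mathfrak n_4,J_t)$ with $J_te_1=e_3$, $J_te_2=e_4$, $J_te_5=t\,e_6$, $t\in(0,1]$; \item $(\mathfrak n_5,J)$ with $Je_1=e_2$, $Je_3=-e_4$, $Je_5=e_6$; \item $(\mathfrak n_6,J)$ with $Je_1=e_2$, $Je_3=-e_6$, $Je_4=e_5$; \item $(\mathfrak n_7,J_t)$ with $J_te_1=e_2$, $J_te_3=-e_4$, $J_te_5=t\,e_6$, $0<|t|\le 1$. \end{enumerate} (In particular, distinct values of the sign in (2), and of the parameters in (3), (4) and (7), give pairs that are not holomorphically isomorphic.)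
   Context: An abelian complex structure on a real Lie algebra $\mathfrak g$ is a linear endomorphism $J$ of $\mathfrak g$ with $J^2=-I$ and $[Jx,Jy]=[x,y]$ for all $x,y\in\mathfrak g$. Two pairs $(\mathfrak g_1,J_1)$, $(\mathfrak g_2,J_2)$ of Lie algebras with complex structures are holomorphically isomorphic if there is a Lie algebra isomorphism $\alpha:\mathfrak g_1\to\mathfrak g_2$ with $J_2\alpha=\alpha J_1$. The Lie algebras are defined on a basis $e_1,\dots,e_6$ by the following nonzero brackets (up to skew-symmetry): $\mathfrak n_1$: $[e_1,e_2]=e_6$; $\mathfrak n_2$: $[e_1,e_2]=e_6=[e_3,e_4]$; $\mathfrak n_3$: $[e_1,e_2]=e_5$, $[e_3,e_4]=e_6$; $\mathfrak n_4$: $[e_1,e_3]=-[e_2,e_4]=e_5$, $[e_1,e_4]=[e_2,e_3]=e_6$; $\mathfrak n_5$: $[e_1,e_2]=e_5$, $[e_1,e_4]=[e_2,e_3]=e_6$; $\mathfrak n_6$: $[e_1,e_2]=e_5$, $[e_1,e_4]=[e_2,e_5]=e_6$; $\mathfrak n_7$: $[e_1,e_2]=e_4$, $[e_1,e_3]=-[e_2,e_4]=e_5$, $[e_1,e_4]=[e_2,e_3]=e_6$. Each $J$ is specified on some basis vectors; its values on the others are determined by $J^2=-I$. *)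

(* Defs.v *)
From HB Require Import structures.
From mathcomp Require Import all_boot all_order all_algebra.
From mathcomp Require Import reals.
From mathcomp Require Import ring.

Set Implicit Arguments.
Unset Strict Implicit.
Unset Printing Implicit Defensive.

Import Order.TTheory GRing.Theory Num.Theory.
Local Open Scope ring_scope.

Definition jacobi (V : zmodType) (br : V -> V -> V) : Prop :=
  forall x y z, br x (br y z) + br y (br z x) + br z (br x y) = 0.

Record lieAlgebra (F : fieldType) : Type := LieAlgebra {
  lie_vect :> vectType F;
  lie_br : lie_vect -> lie_vect -> lie_vect;
  lie_linearr : forall x, linear (lie_br x);
  lie_linearl : forall y, linear (lie_br^~ y);
  lie_alt : forall x, lie_br x x = 0;
  lie_jacobi : jacobi lie_br
}.

Notation "'[lie' x , y ]" := (lie_br x y)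
  (at level 0, x, y at level 99) : ring_scope.

Definition lie_abelian (F : fieldType) (g : lieAlgebra F) : Prop :=
  forall x y : g, [lie x, y] = 0.

(* The subspace spanned by the brackets of elements of U with elements of W;
   by bilinearity it is enough to take the brackets of basis vectors, as
   prodv does for products. *)
Definition lie_prodv (F : fieldType) (g : lieAlgebra F) (U W : {vspace g}) :
    {vspace g} :=
  <<[seq [lie u, w] | u <- vbasis U, w <- vbasis W]>>%VS.

Fixpoint lower_central (F : fieldType) (g : lieAlgebra F) (k : nat) :
    {vspace g} :=
  if k is k'.+1 then lie_prodv fullv (lower_central g k') else fullv.

Definition lie_nilpotent (F : fieldType) (g : lieAlgebra F) : Prop :=
  exists k, lower_central g k = 0%VS.

Definition abelian_complex_structure (F : fieldType) (g : lieAlgebra F)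
    (J : 'End(g)) : Prop :=
  (forall x, J (J x) = - x) /\ (forall x y, [lie J x, J y] = [lie x, y]).

Record liePair (F : fieldType) : Type := LiePair {
  pair_lie : lieAlgebra F;
  pair_J : 'End(pair_lie)
}.

Definition holomorphically_isomorphic (F : fieldType) (P Q : liePair F) :
    Prop :=
  exists f : 'Hom(pair_lie P, pair_lie Q),
    [/\ bijective f,
        forall x y, f [lie x, y] = [lie f x, f y] &
        forall x, pair_J Q (f x) = f (pair_J P x)].

(* Basis vectors and coordinates are numbered from 1 to 6, whence the .-1. *)
Definition e {F : fieldType} (k : nat) : 'rV[F]_6 := delta_mx 0 (inord k.-1).

Definition crd {F : fieldType} (x : 'rV[F]_6) (k : nat) : F :=
  x 0 (inord k.-1).

(* The alternating bilinear map with [e_i, e_j] = v for each (i, j, v) in the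
   table, all brackets of basis vectors not in the table (up to
   skew-symmetry) being zero. *)
Definition table_br {F : fieldType} (T : seq (nat * nat * 'rV[F]_6))
    (x y : 'rV[F]_6) : 'rV[F]_6 :=
  \sum_(r <- T) (crd x r.1.1 * crd y r.1.2 - crd x r.1.2 * crd y r.1.1) *: r.2.

Lemma table_br_linearr (F : fieldType) (T : seq (nat * nat * 'rV[F]_6)) x :
  linear (table_br T x).
Proof.
move=> a u v; rewrite /table_br scaler_sumr -big_split /=.
apply: eq_bigr => r _; rewrite scalerA -scalerDl /crd !mxE; congr (_ *: _).
ring.
Qed.

Lemma table_br_linearl (F : fieldType) (T : seq (nat * nat * 'rV[F]_6)) y :
  linear ((table_br T)^~ y).
Proof.
move=> a u v; rewrite /table_br scaler_sumr -big_split /=.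
apply: eq_bigr => r _; rewrite scalerA -scalerDl /crd !mxE; congr (_ *: _).
ring.
Qed.

Lemma table_br_alt (F : fieldType) (T : seq (nat * nat * 'rV[F]_6)) x :
  table_br T x x = 0.
Proof.
rewrite /table_br big1 // => r _.
by rewrite [X in _ - X]mulrC subrr scale0r.
Qed.

Definition table_lie (F : fieldType) (T : seq (nat * nat * 'rV[F]_6))
    (jT : jacobi (table_br T)) : lieAlgebra F :=
  @LieAlgebra F 'rV[F]_6 (table_br T) (table_br_linearr T)
    (table_br_linearl T) (table_br_alt T) jT.

Definition T1 (F : fieldType) : seq (nat * nat * 'rV[F]_6) :=
  [:: (1%N, 2%N, e 6)].
Definition T2 (F : fieldType) : seq (nat * nat * 'rV[F]_6) :=
  [:: (1%N, 2%N, e 6); (3%N, 4%N, e 6)].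
Definition T3 (F : fieldType) : seq (nat * nat * 'rV[F]_6) :=
  [:: (1%N, 2%N, e 5); (3%N, 4%N, e 6)].
Definition T4 (F : fieldType) : seq (nat * nat * 'rV[F]_6) :=
  [:: (1%N, 3%N, e 5); (2%N, 4%N, - e 5); (1%N, 4%N, e 6); (2%N, 3%N, e 6)].
Definition T5 (F : fieldType) : seq (nat * nat * 'rV[F]_6) :=
  [:: (1%N, 2%N, e 5); (1%N, 4%N, e 6); (2%N, 3%N, e 6)].
Definition T6 (F : fieldType) : seq (nat * nat * 'rV[F]_6) :=
  [:: (1%N, 2%N, e 5); (1%N, 4%N, e 6); (2%N, 5%N, e 6)].
Definition T7 (F : fieldType) : seq (nat * nat * 'rV[F]_6) :=
  [:: (1%N, 2%N, e 4); (1%N, 3%N, e 5); (2%N, 4%N, - e 5);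
      (1%N, 4%N, e 6); (2%N, 3%N, e 6)].

Lemma crd_e (F : fieldType) k l : (0 < k <= 6)%N -> (0 < l <= 6)%N ->
  crd (e k : 'rV[F]_6) l = (k == l)%:R.
Proof.
case: k => // k; case: l => // l; rewrite /= => kP lP.
by rewrite /crd /e mxE eqxx /= -val_eqE /= !inordK // eq_sym eqSS.
Qed.

Lemma crdP (F : fieldType) (x y : 'rV[F]_6) :
  (forall k, (0 < k <= 6)%N -> crd x k = crd y k) -> x = y.
Proof.
move=> xy; apply/rowP => j; have := xy j.+1 (ltn_ord j).
by rewrite /crd /= inord_val.
Qed.

Lemma crdD (F : fieldType) (x y : 'rV[F]_6) k :
  crd (x + y) k = crd x k + crd y k.
Proof. by rewrite /crd mxE. Qed.

Lemma crdN (F : fieldType) (x : 'rV[F]_6) k : crd (- x) k = - crd x k.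
Proof. by rewrite /crd mxE. Qed.

Lemma crdZ (F : fieldType) a (x : 'rV[F]_6) k : crd (a *: x) k = a * crd x k.
Proof. by rewrite /crd mxE. Qed.

Lemma crd0 (F : fieldType) k : crd (0 : 'rV[F]_6) k = 0.
Proof. by rewrite /crd mxE. Qed.

Definition crdE := (crdD, crdN, crdZ, crd0).

Lemma crdP6 (F : fieldType) (x y : 'rV[F]_6) :
  [/\ crd x 1 = crd y 1, crd x 2 = crd y 2 & crd x 3 = crd y 3] ->
  [/\ crd x 4 = crd y 4, crd x 5 = crd y 5 & crd x 6 = crd y 6] -> x = y.
Proof. by move=> [x1 x2 x3] [x4 x5 x6]; apply: crdP; do 7! [case=> //]. Qed.

Ltac crd_table :=
  refine (_, _, _, _, _, _);
  rewrite /table_br !big_cons !big_nil /= ?crdE ?crd_e //=; ring.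

Lemma T1_crd (F : fieldType) (x y : 'rV[F]_6) :
  (crd (table_br (T1 F) x y) 1 = 0) *
  (crd (table_br (T1 F) x y) 2 = 0) *
  (crd (table_br (T1 F) x y) 3 = 0) *
  (crd (table_br (T1 F) x y) 4 = 0) *
  (crd (table_br (T1 F) x y) 5 = 0) *
  (crd (table_br (T1 F) x y) 6 = (crd x 1 * crd y 2 - crd x 2 * crd y 1)).
Proof. by crd_table. Qed.

Lemma T2_crd (F : fieldType) (x y : 'rV[F]_6) :
  (crd (table_br (T2 F) x y) 1 = 0) *
  (crd (table_br (T2 F) x y) 2 = 0) *
  (crd (table_br (T2 F) x y) 3 = 0) *
  (crd (table_br (T2 F) x y) 4 = 0) *
  (crd (table_br (T2 F) x y) 5 = 0) *
  (crd (table_br (T2 F) x y) 6 = (crd x 1 * crd y 2 - crd x 2 * crd y 1) + (crd x 3 * crd y 4 - crd x 4 * crd y 3)).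
Proof. by crd_table. Qed.

Lemma T3_crd (F : fieldType) (x y : 'rV[F]_6) :
  (crd (table_br (T3 F) x y) 1 = 0) *
  (crd (table_br (T3 F) x y) 2 = 0) *
  (crd (table_br (T3 F) x y) 3 = 0) *
  (crd (table_br (T3 F) x y) 4 = 0) *
  (crd (table_br (T3 F) x y) 5 = (crd x 1 * crd y 2 - crd x 2 * crd y 1)) *
  (crd (table_br (T3 F) x y) 6 = (crd x 3 * crd y 4 - crd x 4 * crd y 3)).
Proof. by crd_table. Qed.

Lemma T4_crd (F : fieldType) (x y : 'rV[F]_6) :
  (crd (table_br (T4 F) x y) 1 = 0) *
  (crd (table_br (T4 F) x y) 2 = 0) *
  (crd (table_br (T4 F) x y) 3 = 0) *
  (crd (table_br (T4 F) x y) 4 = 0) *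
  (crd (table_br (T4 F) x y) 5 = (crd x 1 * crd y 3 - crd x 3 * crd y 1) - (crd x 2 * crd y 4 - crd x 4 * crd y 2)) *
  (crd (table_br (T4 F) x y) 6 = (crd x 1 * crd y 4 - crd x 4 * crd y 1) + (crd x 2 * crd y 3 - crd x 3 * crd y 2)).
Proof. by crd_table. Qed.

Lemma T5_crd (F : fieldType) (x y : 'rV[F]_6) :
  (crd (table_br (T5 F) x y) 1 = 0) *
  (crd (table_br (T5 F) x y) 2 = 0) *
  (crd (table_br (T5 F) x y) 3 = 0) *
  (crd (table_br (T5 F) x y) 4 = 0) *
  (crd (table_br (T5 F) x y) 5 = (crd x 1 * crd y 2 - crd x 2 * crd y 1)) *
  (crd (table_br (T5 F) x y) 6 = (crd x 1 * crd y 4 - crd x 4 * crd y 1) + (crd x 2 * crd y 3 - crd x 3 * crd y 2)).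
Proof. by crd_table. Qed.

Lemma T6_crd (F : fieldType) (x y : 'rV[F]_6) :
  (crd (table_br (T6 F) x y) 1 = 0) *
  (crd (table_br (T6 F) x y) 2 = 0) *
  (crd (table_br (T6 F) x y) 3 = 0) *
  (crd (table_br (T6 F) x y) 4 = 0) *
  (crd (table_br (T6 F) x y) 5 = (crd x 1 * crd y 2 - crd x 2 * crd y 1)) *
  (crd (table_br (T6 F) x y) 6 = (crd x 1 * crd y 4 - crd x 4 * crd y 1) + (crd x 2 * crd y 5 - crd x 5 * crd y 2)).
Proof. by crd_table. Qed.

Lemma T7_crd (F : fieldType) (x y : 'rV[F]_6) :
  (crd (table_br (T7 F) x y) 1 = 0) *
  (crd (table_br (T7 F) x y) 2 = 0) *
  (crd (table_br (T7 F) x y) 3 = 0) *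
  (crd (table_br (T7 F) x y) 4 = (crd x 1 * crd y 2 - crd x 2 * crd y 1)) *
  (crd (table_br (T7 F) x y) 5 = (crd x 1 * crd y 3 - crd x 3 * crd y 1) - (crd x 2 * crd y 4 - crd x 4 * crd y 2)) *
  (crd (table_br (T7 F) x y) 6 = (crd x 1 * crd y 4 - crd x 4 * crd y 1) + (crd x 2 * crd y 3 - crd x 3 * crd y 2)).
Proof. by crd_table. Qed.

Lemma T1_jacobi (F : fieldType) : jacobi (table_br (T1 F)).
Proof.
by move=> x y z; apply: crdP6; rewrite !(crdD, crd0) !T1_crd; split; ring.
Qed.

Lemma T2_jacobi (F : fieldType) : jacobi (table_br (T2 F)).
Proof.
by move=> x y z; apply: crdP6; rewrite !(crdD, crd0) !T2_crd; split; ring.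
Qed.

Lemma T3_jacobi (F : fieldType) : jacobi (table_br (T3 F)).
Proof.
by move=> x y z; apply: crdP6; rewrite !(crdD, crd0) !T3_crd; split; ring.
Qed.

Lemma T4_jacobi (F : fieldType) : jacobi (table_br (T4 F)).
Proof.
by move=> x y z; apply: crdP6; rewrite !(crdD, crd0) !T4_crd; split; ring.
Qed.

Lemma T5_jacobi (F : fieldType) : jacobi (table_br (T5 F)).
Proof.
by move=> x y z; apply: crdP6; rewrite !(crdD, crd0) !T5_crd; split; ring.
Qed.

Lemma T6_jacobi (F : fieldType) : jacobi (table_br (T6 F)).
Proof.
by move=> x y z; apply: crdP6; rewrite !(crdD, crd0) !T6_crd; split; ring.
Qed.

Lemma T7_jacobi (F : fieldType) : jacobi (table_br (T7 F)).
Proof.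
by move=> x y z; apply: crdP6; rewrite !(crdD, crd0) !T7_crd; split; ring.
Qed.

(* The linear endomorphism sending e_1, ..., e_6 to the entries of s. *)
Definition basis_end {F : fieldType} (s : seq 'rV[F]_6) : 'End('rV[F]_6) :=
  linfun (mulmxr (\matrix_(k < 6) s`_k)).

(* In all lists below the values on the basis vectors on which the complex
   structure is not prescribed are the ones forced by J (J x) = - x. *)
Definition J1 (F : fieldType) : 'End('rV[F]_6) :=
  basis_end [:: e 2; - e 1; e 4; - e 3; e 6; - e 5].
Definition J2 (F : fieldType) (b : bool) : 'End('rV[F]_6) :=
  basis_end [:: e 2; - e 1; (-1) ^+ b *: e 4; - (-1) ^+ b *: e 3; e 6; - e 5].
Definition J3 (F : fieldType) (s : F) : 'End('rV[F]_6) :=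
  basis_end [:: e 2; - e 1; e 4; - e 3;
                s *: e 5 + e 6; - (1 + s ^+ 2) *: e 5 - s *: e 6].
Definition J4 (F : fieldType) (t : F) : 'End('rV[F]_6) :=
  basis_end [:: e 3; e 4; - e 1; - e 2; t *: e 6; - t^-1 *: e 5].
Definition J5 (F : fieldType) : 'End('rV[F]_6) :=
  basis_end [:: e 2; - e 1; - e 4; e 3; e 6; - e 5].
Definition J6 (F : fieldType) : 'End('rV[F]_6) :=
  basis_end [:: e 2; - e 1; - e 6; e 5; - e 4; e 3].
Definition J7 (F : fieldType) (t : F) : 'End('rV[F]_6) :=
  basis_end [:: e 2; - e 1; - e 4; e 3; t *: e 6; - t^-1 *: e 5].

Definition n1 (F : fieldType) : lieAlgebra F := table_lie (@T1_jacobi F).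
Definition n2 (F : fieldType) : lieAlgebra F := table_lie (@T2_jacobi F).
Definition n3 (F : fieldType) : lieAlgebra F := table_lie (@T3_jacobi F).
Definition n4 (F : fieldType) : lieAlgebra F := table_lie (@T4_jacobi F).
Definition n5 (F : fieldType) : lieAlgebra F := table_lie (@T5_jacobi F).
Definition n6 (F : fieldType) : lieAlgebra F := table_lie (@T6_jacobi F).
Definition n7 (F : fieldType) : lieAlgebra F := table_lie (@T7_jacobi F).

(* L2 false and L2 true stand for J_+ and J_- respectively. *)
Inductive label (F : Type) : Type :=
| L1
| L2 of bool
| L3 of F
| L4 of F
| L5
| L6
| L7 of F.

Definition admissible (R : realDomainType) (l : label R) : Prop :=
  match l with
  | L4 t => 0 < t <= 1
  | L7 t => 0 < `|t| <= 1
  | _ => True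
  end.

Definition listed_pair (F : fieldType) (l : label F) : liePair F :=
  match l with
  | L1 => @LiePair F (n1 F) (J1 F)
  | L2 b => @LiePair F (n2 F) (J2 F b)
  | L3 s => @LiePair F (n3 F) (J3 s)
  | L4 t => @LiePair F (n4 F) (J4 t)
  | L5 => @LiePair F (n5 F) (J5 F)
  | L6 => @LiePair F (n6 F) (J6 F)
  | L7 t => @LiePair F (n7 F) (J7 t)
  end.

Lemma basis_endE (F : fieldType) (s : seq 'rV[F]_6) x :
  basis_end s x = crd x 1 *: s`_0 + crd x 2 *: s`_1 + crd x 3 *: s`_2
                + crd x 4 *: s`_3 + crd x 5 *: s`_4 + crd x 6 *: s`_5.
Proof.
rewrite lfunE /= mulmx_sum_row (eq_bigr (fun k : 'I_6 => crd x k.+1 *: s`_k)).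
  by rewrite !big_ord_recr big_ord0 /= add0r.
by move=> k _; rewrite rowK /crd /= inord_val.
Qed.

Ltac crd_J :=
  refine (_, _, _, _, _, _);
  rewrite basis_endE /= ?crdE ?crd_e //=; ring.

Lemma J1_crd (F : fieldType) (x : 'rV[F]_6) :
  (crd (J1 F x) 1 = - crd x 2) *
  (crd (J1 F x) 2 = crd x 1) *
  (crd (J1 F x) 3 = - crd x 4) *
  (crd (J1 F x) 4 = crd x 3) *
  (crd (J1 F x) 5 = - crd x 6) *
  (crd (J1 F x) 6 = crd x 5).
Proof. by rewrite /J1; crd_J. Qed.

Lemma J2_crd (F : fieldType) (b : bool) (x : 'rV[F]_6) :
  (crd (J2 F b x) 1 = - crd x 2) *
  (crd (J2 F b x) 2 = crd x 1) *
  (crd (J2 F b x) 3 = - (-1) ^+ b * crd x 4) *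
  (crd (J2 F b x) 4 = (-1) ^+ b * crd x 3) *
  (crd (J2 F b x) 5 = - crd x 6) *
  (crd (J2 F b x) 6 = crd x 5).
Proof. by rewrite /J2; crd_J. Qed.

Lemma J3_crd (F : fieldType) (s : F) (x : 'rV[F]_6) :
  (crd (J3 s x) 1 = - crd x 2) *
  (crd (J3 s x) 2 = crd x 1) *
  (crd (J3 s x) 3 = - crd x 4) *
  (crd (J3 s x) 4 = crd x 3) *
  (crd (J3 s x) 5 = s * crd x 5 - (1 + s ^+ 2) * crd x 6) *
  (crd (J3 s x) 6 = crd x 5 - s * crd x 6).
Proof. by rewrite /J3; crd_J. Qed.

Lemma J4_crd (F : fieldType) (t : F) (x : 'rV[F]_6) :
  (crd (J4 t x) 1 = - crd x 3) *
  (crd (J4 t x) 2 = - crd x 4) *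
  (crd (J4 t x) 3 = crd x 1) *
  (crd (J4 t x) 4 = crd x 2) *
  (crd (J4 t x) 5 = - t^-1 * crd x 6) *
  (crd (J4 t x) 6 = t * crd x 5).
Proof. by rewrite /J4; crd_J. Qed.

Lemma J5_crd (F : fieldType) (x : 'rV[F]_6) :
  (crd (J5 F x) 1 = - crd x 2) *
  (crd (J5 F x) 2 = crd x 1) *
  (crd (J5 F x) 3 = crd x 4) *
  (crd (J5 F x) 4 = - crd x 3) *
  (crd (J5 F x) 5 = - crd x 6) *
  (crd (J5 F x) 6 = crd x 5).
Proof. by rewrite /J5; crd_J. Qed.

Lemma J6_crd (F : fieldType) (x : 'rV[F]_6) :
  (crd (J6 F x) 1 = - crd x 2) *
  (crd (J6 F x) 2 = crd x 1) *
  (crd (J6 F x) 3 = crd x 6) *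
  (crd (J6 F x) 4 = - crd x 5) *
  (crd (J6 F x) 5 = crd x 4) *
  (crd (J6 F x) 6 = - crd x 3).
Proof. by rewrite /J6; crd_J. Qed.

Lemma J7_crd (F : fieldType) (t : F) (x : 'rV[F]_6) :
  (crd (J7 t x) 1 = - crd x 2) *
  (crd (J7 t x) 2 = crd x 1) *
  (crd (J7 t x) 3 = crd x 4) *
  (crd (J7 t x) 4 = - crd x 3) *
  (crd (J7 t x) 5 = - t^-1 * crd x 6) *
  (crd (J7 t x) 6 = t * crd x 5).
Proof. by rewrite /J7; crd_J. Qed.

Lemma listed_pair_complex (R : realFieldType) (l : label R) :
  admissible l -> abelian_complex_structure (pair_J (listed_pair l)).
Proof.
case: l => [|b|s|t| | |t] /= hl.
- by split=> [x|x y]; apply: crdP6;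
    rewrite ?crdE ?(T1_crd, J1_crd); split; ring.
- by split=> [x|x y]; apply: crdP6;
    rewrite ?crdE ?(T2_crd, J2_crd); split; case: b hl => _; ring.
- by split=> [x|x y]; apply: crdP6;
    rewrite ?crdE ?(T3_crd, J3_crd); split; ring.
- have t0 : t != 0 by case/andP: hl => /lt0r_neq0.
  by split=> [x|x y]; apply: crdP6;
    rewrite ?crdE ?(T4_crd, J4_crd); split; try ring; field.
- by split=> [x|x y]; apply: crdP6;
    rewrite ?crdE ?(T5_crd, J5_crd); split; ring.
- by split=> [x|x y]; apply: crdP6;
    rewrite ?crdE ?(T6_crd, J6_crd); split; ring.
- have t0 : t != 0 by case/andP: hl; rewrite normr_gt0.
  by split=> [x|x y]; apply: crdP6;
    rewrite ?crdE ?(T7_crd, J7_crd); split; try ring; field.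
Qed.

Lemma mem_lie_prodv (F : fieldType) (g : lieAlgebra F) (U W : {vspace g}) u w :
  u \in U -> w \in W -> [lie u, w] \in lie_prodv U W.
Proof.
move=> /coord_vbasis -> /coord_vbasis ->.
have brsl y (I : finType) (c : I -> F) (v : I -> g) :
  [lie \sum_i c i *: v i, y] = \sum_i c i *: [lie v i, y].
  pose f := GRing.isLinear.Build F g g _ (fun x => [lie x, y]) (@lie_linearl F g y).
  pose L : {linear g -> g} := HB.pack (fun x => [lie x, y]) f.
  by rewrite -[LHS]/(L _) linear_sum; apply: eq_bigr => i _; rewrite linearZ.
have brsr y (I : finType) (c : I -> F) (v : I -> g) :
  [lie y, \sum_i c i *: v i] = \sum_i c i *: [lie y, v i].
  pose f := GRing.isLinear.Build F g g _ (lie_br y) (@lie_linearr F g y).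
  pose L : {linear g -> g} := HB.pack (lie_br y) f.
  by rewrite -[LHS]/(L _) linear_sum; apply: eq_bigr => i _; rewrite linearZ.
rewrite brsl; apply: memv_suml => i _; apply: memvZ.
rewrite brsr; apply: memv_suml => j _; apply: memvZ.
by apply/memv_span/allpairs_f; rewrite mem_nth ?size_tuple.
Qed.

Lemma lie_prodv_sub (F : fieldType) (g : lieAlgebra F) (U W X : {vspace g}) :
  (forall u w, u \in U -> w \in W -> [lie u, w] \in X) ->
  (lie_prodv U W <= X)%VS.
Proof.
move=> UWX; apply/span_subvP => _ /allpairsP[[u w] [/= uU wW ->]].
by apply: UWX; exact: vbasis_mem.
Qed.

Lemma nilpotent3 (F : fieldType) (g : lieAlgebra F) :
  (forall x y z w : g, [lie x, [lie y, [lie z, w]]] = 0) -> lie_nilpotent g.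
Proof.
move=> g3; exists 3%N; apply/eqP; rewrite -subv0.
apply: lie_prodv_sub => x v _ /= vV; rewrite memv0; apply/eqP.
pose f1 y := GRing.isLinear.Build F g g _ (lie_br y) (@lie_linearr F g y).
pose L y : {linear g -> g} := HB.pack (lie_br y) (f1 y).
have H2 y w : w \in lie_prodv fullv (fullv : {vspace g}) ->
    [lie x, [lie y, w]] = 0.
  have /subvP sub : (lie_prodv fullv (fullv : {vspace g}) <=
      lker (linfun (L x) \o linfun (L y)))%VS.
    apply: lie_prodv_sub => z t _ _.
    by rewrite memv_ker comp_lfunE !lfunE /= g3.
  by move=> /sub; rewrite memv_ker comp_lfunE !lfunE => /eqP.
have /subvP sub : (lie_prodv fullv (lie_prodv fullv (fullv : {vspace g})) <=
      lker (linfun (L x)))%VS.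
  by apply: lie_prodv_sub => y w _ wW; rewrite memv_ker lfunE /= H2.
by move: vV => /sub; rewrite memv_ker lfunE => /eqP.
Qed.

Lemma listed_pair_nilpotent (F : fieldType) (l : label F) :
  lie_nilpotent (pair_lie (listed_pair l)).
Proof.
case: l => [|b|s|t| | |t]; apply: nilpotent3 => x y z w;
  rewrite /lie_br /=.
- by apply: crdP6; rewrite !crd0 !T1_crd; split; ring.
- by apply: crdP6; rewrite !crd0 !T2_crd; split; ring.
- by apply: crdP6; rewrite !crd0 !T3_crd; split; ring.
- by apply: crdP6; rewrite !crd0 !T4_crd; split; ring.
- by apply: crdP6; rewrite !crd0 !T5_crd; split; ring.
- by apply: crdP6; rewrite !crd0 !T6_crd; split; ring.
- by apply: crdP6; rewrite !crd0 !T7_crd; split; ring.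
Qed.

Lemma listed_pair_nonabelian (F : fieldType) (l : label F) :
  ~ lie_abelian (pair_lie (listed_pair l)).
Proof.
have c j k (T : seq (nat * nat * 'rV[F]_6)) (jT : jacobi (table_br T)) i :
    crd (table_br T (e j) (e k)) i = 1 -> ~ lie_abelian (table_lie jT).
  move=> h /(_ (e j) (e k)) h0; move: h; rewrite [table_br _ _ _]h0 crd0.
  by move/eqP; rewrite eq_sym oner_eq0.
case: l => [|b|s|t| | |t];
  [apply: (c 1%N 2%N _ _ 6%N)|apply: (c 1%N 2%N _ _ 6%N)
  |apply: (c 1%N 2%N _ _ 5%N)|apply: (c 1%N 3%N _ _ 5%N)
  |apply: (c 1%N 2%N _ _ 5%N)|apply: (c 1%N 2%N _ _ 5%N)
  |apply: (c 1%N 2%N _ _ 4%N)];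
  rewrite /table_br !big_cons !big_nil /= ?crdE ?crd_e //=; ring.
Qed.

(* Main.v *)
(* A complex subspace U of n (U = JU) has even dimension, and nilpotency gives
   v outside U with [n, v] in U whenever U <> n. The center Z is complex. If
   dim Z = 4, then [x, Jx] spans n', which is the first case. Otherwise
   dim Z = 2 and n is determined by J on Z together with a = [x, Jx],
   b = [x, y], c = [x, Jy] and d = [y, Jy], where x, Jx, y, Jy is a basis
   modulo Z.
   If n is not 2-step, one can take Jy = [x, Jx], so that d = 0 and b, c lie in
   Z; rotating x kills c when b and c are dependent (case 6) and otherwise puts
   J in the form J b = t c (case 7).
   If n is 2-step, the bracket is a pencil of Hermitian forms on n/Z with values
   in Z. When there is a noncentral y with [y, Jy] = 0, changes of x lead to the
   indefinite form in (2) and to (4) and (5); when there is none, the forms can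
   be diagonalized simultaneously, which gives the definite form in (2) and (3).
   The listed pairs are told apart by the isotropic vectors ([x, Jx] = 0) and
   the dimensions of the spans of the double and triple brackets, and the
   parameters by writing out f J = J' f on the image of the center. *)
From HB Require Import structures.
Require Import Defs.
From mathcomp Require Import all_boot all_order all_algebra.
From mathcomp Require Import boolp reals.
From mathcomp Require Import ring lra.

Set Implicit Arguments.
Unset Strict Implicit.
Unset Printing Implicit Defensive.

Import Order.TTheory GRing.Theory Num.Theory.
Local Open Scope ring_scope.

(** * Lie brackets, complex structures and frames *)

Section LieTheory.
Variables (F : fieldType) (g : lieAlgebra F).
Implicit Types (x y z : g) (k : F).

Lemma lieDl x y z : [lie x + y, z] = [lie x, z] + [lie y, z].
Proof. by have := @lie_linearl F g z 1 x y; rewrite !scale1r. Qed.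

Lemma lieDr x y z : [lie z, x + y] = [lie z, x] + [lie z, y].
Proof. by have := @lie_linearr F g z 1 x y; rewrite !scale1r. Qed.

Lemma lie0l x : [lie 0, x] = 0.
Proof. by apply: (addrI [lie 0, x]); rewrite -lieDl !addr0. Qed.

Lemma lie0r x : [lie x, 0] = 0.
Proof. by apply: (addrI [lie x, 0]); rewrite -lieDr !addr0. Qed.

Lemma lieZl k x y : [lie k *: x, y] = k *: [lie x, y].
Proof. by have := @lie_linearl F g y k x 0; rewrite lie0l !addr0. Qed.

Lemma lieZr k x y : [lie y, k *: x] = k *: [lie y, x].
Proof. by have := @lie_linearr F g y k x 0; rewrite lie0r !addr0. Qed.

Lemma lieNl x y : [lie - x, y] = - [lie x, y].
Proof. by rewrite -scaleN1r lieZl scaleN1r. Qed.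

Lemma lieNr x y : [lie y, - x] = - [lie y, x].
Proof. by rewrite -scaleN1r lieZr scaleN1r. Qed.

Lemma lieC x y : [lie y, x] = - [lie x, y].
Proof.
apply/eqP; rewrite -addr_eq0; apply/eqP.
by have := lie_alt (x + y); rewrite lieDl !lieDr !lie_alt add0r addr0 addrC.
Qed.

Definition lieE := (lieDl, lieDr, lieNl, lieNr, lieZl, lieZr, lie0l, lie0r).

Definition central x := forall y, [lie x, y] = 0.

Lemma centralr x y : central x -> [lie y, x] = 0.
Proof. by move=> cx; rewrite lieC cx oppr0. Qed.

Lemma centralD x y : central x -> central y -> central (x + y).
Proof. by move=> cx cy z; rewrite lieDl cx cy addr0. Qed.

Lemma centralZ k x : central x -> central (k *: x).
Proof. by move=> cx z; rewrite lieZl cx scaler0. Qed.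

Lemma centralN x : central x -> central (- x).
Proof. by move=> cx z; rewrite lieNl cx oppr0. Qed.

End LieTheory.

(** Linear functionals separate vectors. Hence [vec] can apply an arbitrary functional and leave an
    identity between scalars to [ring], the values [phi v] being atoms. *)
Lemma coord_inj (F : fieldType) (V : vectType F) (u v : V) :
  (forall phi : {scalar V}, phi u = phi v) -> u = v.
Proof.
move=> uv; rewrite (coord_vbasis (memvf u)) (coord_vbasis (memvf v)).
by apply: eq_bigr => i _; congr (_ *: _); exact: uv.
Qed.

Ltac vec :=
  let phi := fresh "phi" in
  apply: coord_inj => phi;
  rewrite ?(linearD, linearN, linearZ, linear0) /=; try ring.

Section Complex.
Variables (F : fieldType) (g : lieAlgebra F) (J : 'End(g)).
Hypothesis acsJ : abelian_complex_structure J.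

Lemma cplxK x : J (J x) = - x. Proof. by case: acsJ. Qed.

Lemma lieJJ x y : [lie J x, J y] = [lie x, y]. Proof. by case: acsJ. Qed.

Lemma lieJl x y : [lie J x, y] = - [lie x, J y].
Proof. by rewrite -lieJJ cplxK lieNl. Qed.

Lemma lieJC x y : [lie y, J x] = [lie x, J y].
Proof. by rewrite lieC lieJl opprK. Qed.

Lemma centralJ x : central x -> central (J x).
Proof. by move=> cx y; rewrite lieJl cx oppr0. Qed.

End Complex.

Section Frame.
Variables (F : fieldType) (g : lieAlgebra F) (J : 'End(g)).

Definition frame (x y w z : g) (c : 'rV[F]_6) : g :=
  crd c 1 *: x + crd c 2 *: J x + crd c 3 *: y + crd c 4 *: J y
  + crd c 5 *: w + crd c 6 *: z.

Lemma frame_is_linear x y w z : linear (frame x y w z).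
Proof. by move=> k u v; rewrite /frame !crdE; vec. Qed.

Lemma frame0 x y w z : frame x y w z 0 = 0.
Proof. by rewrite /frame !crd0 !scale0r !addr0. Qed.

Lemma frame_e x y w z :
  (frame x y w z (e 3) = y) * (frame x y w z (e 4) = J y) *
  (frame x y w z (e 5) = w) * (frame x y w z (e 6) = z).
Proof.
by do !split; rewrite /frame !crd_e //= !(scale0r, scale1r, add0r, addr0).
Qed.

(** The bracket is invariant under J, so the four values stored here determine all brackets of x,
    Jx, y, Jy. Their coordinates are taken in the frame itself, which makes [a b c d p q] data that
    two different pairs can share. *)
Record presents (a b c d : 'rV[F]_6) (p q : F) (x y w z : g) : Prop := Presents {
  presents_free : forall u, frame x y w z u = 0 -> u = 0;
  presents_centralw : central w;
  presents_centralz : central z;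
  presents_xJx : [lie x, J x] = frame x y w z a;
  presents_xy : [lie x, y] = frame x y w z b;
  presents_xJy : [lie x, J y] = frame x y w z c;
  presents_yJy : [lie y, J y] = frame x y w z d;
  presents_Jw : J w = p *: w + q *: z
}.

Definition presentable (a b c d : 'rV[F]_6) (p q : F) : Prop :=
  exists x y w z, presents a b c d p q x y w z.

Hypothesis acsJ : abelian_complex_structure J.

Lemma frame_lie x y w z : central w -> central z -> forall u v,
  [lie frame x y w z u, frame x y w z v] =
    (crd u 1 * crd v 2 - crd u 2 * crd v 1) *: [lie x, J x]
  + (crd u 1 * crd v 3 - crd u 3 * crd v 1
     + crd u 2 * crd v 4 - crd u 4 * crd v 2) *: [lie x, y]
  + (crd u 1 * crd v 4 - crd u 4 * crd v 1
     - crd u 2 * crd v 3 + crd u 3 * crd v 2) *: [lie x, J y]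
  + (crd u 3 * crd v 4 - crd u 4 * crd v 3) *: [lie y, J y].
Proof.
move=> cw cz u v; rewrite /frame !lieE !(centralr _ cw, centralr _ cz) !cw !cz.
rewrite !(lieJJ acsJ, lieJl acsJ) !lie_alt (lieC x y) (lieJC acsJ x y) !scaler0.
vec.
Qed.

Lemma frame_cplx p q x y w z : q != 0 -> J w = p *: w + q *: z -> forall u,
  J (frame x y w z u) = frame x y w z
   (- crd u 2 *: e 1 + crd u 1 *: e 2 - crd u 4 *: e 3 + crd u 3 *: e 4
    + (p * crd u 5 - q^-1 * (1 + p ^+ 2) * crd u 6) *: e 5
    + (q * crd u 5 - p * crd u 6) *: e 6).
Proof.
move=> q0 Jw u.
(* Applying J to J w = p w + q z gives q (J z) = - w - p (J w), so J z is forced once q is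
   invertible. *)
have Jz : J z = - (q^-1 * (1 + p ^+ 2)) *: w - p *: z.
  have : q *: J z = - w - p *: J w.
    have := cplxK acsJ w; rewrite {1}Jw linearD !linearZ /= => <-.
    by vec.
  move/(congr1 (fun v => q^-1 *: v)); rewrite scalerA mulVf // scale1r => ->.
  by rewrite Jw; vec; field.
rewrite /frame !linearD !linearZ /= !(cplxK acsJ) Jw Jz ?crdE ?crd_e //=; vec.
Qed.

End Frame.

(** * Isomorphisms between pairs with the same frame data *)

Section Iso.
Variables (F : fieldType).

Lemma hom_bijective (U V : vectType F) (f : 'Hom(U, V)) :
  (forall u, f u = 0 -> u = 0) -> \dim (fullv : {vspace U}) = \dim (fullv : {vspace V}) ->
  bijective f.
Proof.
move=> f0 dUV; have kf : lker f == 0%VS.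
  by apply/lker0P/raddf_inj => u /f0.
have lf : limg f = fullv.
  by apply/eqP; rewrite eqEdim subvf /= limg_dim_eq ?dUV // (eqP kf) capv0.
exists (f^-1)%VF; first exact: lker0_lfunK.
by move=> v; rewrite limg_lfunVK // lf memvf.
Qed.

Lemma holo_sym (P Q : liePair F) :
  holomorphically_isomorphic P Q -> holomorphically_isomorphic Q P.
Proof.
move=> [f [[h fK hK] fl fJ]].
have kf : lker f == 0%VS by apply/lker0P/(can_inj fK).
have fVK : cancel (f^-1)%VF f.
  by move=> v; rewrite -[v]hK lker0_lfunK.
have Vf : cancel f (f^-1)%VF by exact: lker0_lfunK.
exists (f^-1)%VF; split; first by exists f.
- by move=> x y; apply: (can_inj Vf); rewrite fl !fVK.
- by move=> x; apply: (can_inj Vf); rewrite -fJ !fVK.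
Qed.

Lemma holo_trans (P Q S : liePair F) :
  holomorphically_isomorphic P Q -> holomorphically_isomorphic Q S ->
  holomorphically_isomorphic P S.
Proof.
move=> [f [bf fl fJ]] [h [bh hl hJ]]; exists (h \o f)%VF; split.
- by apply: (eq_bij (bij_comp bh bf)) => x; rewrite comp_lfunE.
- by move=> x y; rewrite !comp_lfunE fl hl.
- by move=> x; rewrite !comp_lfunE hJ fJ.
Qed.

Variables (P Q : liePair F).
Hypothesis dimP : \dim (fullv : {vspace (pair_lie P)}) = 6%N.
Hypothesis dimQ : \dim (fullv : {vspace (pair_lie Q)}) = 6%N.
Hypothesis acsP : abelian_complex_structure (pair_J P).
Hypothesis acsQ : abelian_complex_structure (pair_J Q).

(** The isomorphism carries one frame to the other. In frame coordinates the bracket and J are given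
    on both sides by the same formulas, [frame_lie] and [frame_cplx], which involve only the shared
    data. *)
Lemma presentable_holo a b c d p q : q != 0 ->
  presentable (pair_J P) a b c d p q -> presentable (pair_J Q) a b c d p q ->
  holomorphically_isomorphic P Q.
Proof.
move=> q0 [x [y [w [z [fP cw cz xx xy xJ yy Jw]]]]].
move=> [x' [y' [w' [z' [fQ cw' cz' xx' xy' xJ' yy' Jw']]]]].
pose LP := GRing.isLinear.Build F 'rV[F]_6 (pair_lie P) _ _
  (frame_is_linear (pair_J P) x y w z).
pose HP : {linear 'rV[F]_6 -> pair_lie P} := HB.pack (frame (pair_J P) x y w z) LP.
pose LQ := GRing.isLinear.Build F 'rV[F]_6 (pair_lie Q) _ _
  (frame_is_linear (pair_J Q) x' y' w' z').
pose HQ : {linear 'rV[F]_6 -> pair_lie Q} := HB.pack (frame (pair_J Q) x' y' w' z') LQ.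
have hP u : linfun HP u = frame (pair_J P) x y w z u by rewrite lfunE.
have hQ u : linfun HQ u = frame (pair_J Q) x' y' w' z' u by rewrite lfunE.
have bP : bijective (linfun HP).
  by apply: hom_bijective => [u|]; rewrite ?hP ?dimP ?dimvf // => /fP.
have bQ : bijective (linfun HQ).
  by apply: hom_bijective => [u|]; rewrite ?hQ ?dimQ ?dimvf // => /fQ.
have [h hK Kh] := bP.
pose k := (linfun HP)^-1%VF.
have kK : cancel (linfun HP) k by apply/lker0_lfunK/lker0P/(can_inj hK).
have Kk : cancel k (linfun HP) by move=> v; rewrite -[v]Kh kK.
exists (linfun HQ \o k)%VF; split.
- have bk : bijective k by exists (linfun HP).
  by apply: (eq_bij (bij_comp bQ bk)) => v; rewrite comp_lfunE.
- move=> u v; rewrite -[u]Kk -[v]Kk !comp_lfunE !kK.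
  move: (k u) (k v) => {}u {}v; rewrite !hP !hQ.
  rewrite (frame_lie acsP) // (frame_lie acsQ) //.
  rewrite xx xy xJ yy xx' xy' xJ' yy' -!hP -!hQ.
  by rewrite -!linearZ -!linearD kK !linearD !linearZ.
- move=> u; rewrite -[u]Kk !comp_lfunE !kK; move: (k u) => {}u.
  by rewrite !hP !hQ (frame_cplx acsP x y q0 Jw) (frame_cplx acsQ x' y' q0 Jw')
    -!hP -!hQ kK.
Qed.

End Iso.

(** * Frame data of the listed pairs *)

Section Listed.
Variable R : realFieldType.

Lemma crd_inj6 (u : 'rV[R]_6) :
  [/\ crd u 1 = 0, crd u 2 = 0 & crd u 3 = 0] ->
  [/\ crd u 4 = 0, crd u 5 = 0 & crd u 6 = 0] -> u = 0.
Proof. by move=> [h1 h2 h3] [h4 h5 h6]; apply: crdP6; rewrite !crd0. Qed.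

Lemma frame_crd0 T jT (J : 'End(@table_lie R T jT)) (x y w z u : 'rV[R]_6) :
  frame J x y w z u = 0 -> forall k,
  crd u 1 * crd x k + crd u 2 * crd (J x) k + crd u 3 * crd y k
  + crd u 4 * crd (J y) k + crd u 5 * crd w k + crd u 6 * crd z k = 0.
Proof.
move=> /(congr1 (fun v => crd v _)) H k.
by rewrite -[RHS](crd0 _ k) -(H k) !crdE.
Qed.

Ltac listed tbl jtbl :=
  split;
  [ let u := fresh "u" in let H := fresh "H" in
    move=> u H;
    move/frame_crd0: H => H;
    move: (H 1%N) (H 2%N) (H 3%N) (H 4%N) (H 5%N) (H 6%N);
    rewrite ?jtbl ?crdE ?crd_e //= => *; apply: crd_inj6; split; lra
  | move=> ?; apply: crdP6; rewrite /lie_br /= !tbl ?crdE ?crd_e //=; split; ring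
  | move=> ?; apply: crdP6; rewrite /lie_br /= !tbl ?crdE ?crd_e //=; split; ring
  | apply: crdP6; rewrite /lie_br /= !tbl ?(frame0, frame_e) ?crdE
      ?jtbl ?crdE ?crd_e //=; split; ring
  | apply: crdP6; rewrite /lie_br /= !tbl ?(frame0, frame_e) ?crdE
      ?jtbl ?crdE ?crd_e //=; split; ring
  | apply: crdP6; rewrite /lie_br /= !tbl ?(frame0, frame_e) ?crdE
      ?jtbl ?crdE ?crd_e //=; split; ring
  | apply: crdP6; rewrite /lie_br /= !tbl ?(frame0, frame_e) ?crdE
      ?jtbl ?crdE ?crd_e //=; split; ring
  | apply: crdP6; rewrite ?crdE ?jtbl ?crdE ?crd_e //=; split; ring ].

Lemma presentable1 : presentable (pair_J (listed_pair (L1 R))) (e 6) 0 0 0 0 1.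
Proof. exists (e 1), (e 3), (e 5), (e 6). listed T1_crd J1_crd. Qed.

Lemma presentable2 b : presentable (pair_J (listed_pair (L2 R b)))
  (if b then 0 else e 6 : 'rV[R]_6) (if b then e 6 else 0 : 'rV[R]_6)
  0 (if b then 0 else e 6 : 'rV[R]_6) 0 1.
Proof.
case: b.
(* For J_- the vectors x = e1 + e3 and y = e2 + e4 are both isotropic, [x, Jy] = 0, and [x, y] = 2
   e6, whence the factors 2. *)
- by exists (e 1 + e 3), (e 2 + e 4), (2 *: e 5), (2 *: e 6);
    listed T2_crd J2_crd.
- by exists (e 1), (e 3), (e 5), (e 6); listed T2_crd J2_crd.
Qed.

Lemma presentable3 (s : R) : presentable (pair_J (listed_pair (L3 s)))
  (e 5) 0 0 (e 6) s 1.
Proof. by exists (e 1), (e 3), (e 5), (e 6); listed T3_crd J3_crd. Qed.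

Lemma presentable4 (t : R) : presentable (pair_J (listed_pair (L4 t)))
  0 (e 5) (e 6) 0 0 t.
Proof.
(* Here too x and y are isotropic; [x, y] = 2 e5 and [x, Jy] = 2 e6. *)
by exists (e 1 + e 4), (e 2 + e 3), (2 *: e 5), (2 *: e 6);
  listed T4_crd J4_crd.
Qed.

Lemma presentable5 : presentable (pair_J (listed_pair (L5 R)))
  (e 5) (e 6) 0 0 0 1.
Proof. by exists (e 1), (e 4), (e 5), (e 6); listed T5_crd J5_crd. Qed.

Lemma presentable6 : presentable (pair_J (listed_pair (L6 R)))
  (e 4) (e 5) 0 0 0 1.
(* The bracket [e1, e2] = e5 equals J e4, which dictates y = e4; the center is spanned by e6 =
   [e1, e4] and e3 = J e6. *)
Proof. by exists (e 1), (e 4), (e 6), (e 3); listed T6_crd J6_crd. Qed.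

Lemma presentable7 (t : R) : presentable (pair_J (listed_pair (L7 t)))
  (e 4) (e 5) (e 6) 0 0 (- t).
(* Taking y = - e3 gives Jy = e4 = [e1, e2]. Then w = [e1, y] = - e5, so J w = - t e6, which is the
   sign of the last parameter. *)
Proof. by exists (e 1), (- e 3), (- e 5), (e 6); listed T7_crd J7_crd. Qed.

End Listed.

(** * Complex subspaces and the center *)

Section SumOfSquares.
Variable R : realDomainType.
Implicit Types m n : R.

Lemma sqr_sum_eq0 m n : m ^+ 2 + n ^+ 2 = 0 -> m = 0 /\ n = 0.
Proof.
move/eqP; rewrite paddr_eq0 ?sqr_ge0 // !sqrf_eq0.
by case/andP => /eqP -> /eqP ->.
Qed.

Lemma sqr_sum_neq0 m n : m != 0 \/ n != 0 -> m ^+ 2 + n ^+ 2 != 0.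
Proof. by case=> h0; apply: contraNneq h0 => /sqr_sum_eq0[mE nE]; apply/eqP. Qed.

End SumOfSquares.

Section Structure.
Variables (R : realFieldType) (g : lieAlgebra R) (J : 'End(g)).
Implicit Types (U : {vspace g}) (x y z v : g).

(** Let m + 1 be the least index at which the lower central series lies in U. Any v in its term m
    outside U will do, as the brackets with v fall into the next term. *)
Lemma nilpotent_growth (U : {vspace g}) : lie_nilpotent g -> U != fullv ->
  exists2 v, v \notin U & forall x, [lie x, v] \in U.
Proof.
move=> [k Ck] nU; have exk : exists k, (lower_central g k <= U)%VS.
  by exists k; rewrite Ck sub0v.
case: (ex_minnP exk) => -[|m] Cm mmin.
  by move: nU; rewrite eqEsubv subvf Cm.
have /subvPn[v vm vU] : ~~ (lower_central g m <= U)%VS.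
  by apply/negP => /mmin; rewrite ltnn.
by exists v => // x; apply: (subvP Cm); apply: mem_lie_prodv; rewrite ?memvf.
Qed.

Hypothesis acsJ : abelian_complex_structure J.

Definition cplx_stable (U : {vspace g}) := forall u, u \in U -> J u \in U.

Lemma stable0 : cplx_stable 0%VS.
Proof. by move=> u; rewrite !memv0 => /eqP ->; rewrite linear0. Qed.

(** Otherwise m + nJ would be invertible, with inverse (m - nJ) / (m^2 + n^2), and this inverse
    preserves U, so x would lie in U. *)
Lemma cplx_indep (U : {vspace g}) x m n : cplx_stable U -> x \notin U ->
  m *: x + n *: J x \in U -> m = 0 /\ n = 0.
Proof.
move=> sU xU vU; apply: sqr_sum_eq0; apply/eqP; apply: contraNT xU => mn0.
have <- : (m ^+ 2 + n ^+ 2)^-1 *: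
    (m *: (m *: x + n *: J x) - n *: J (m *: x + n *: J x)) = x.
  by rewrite !(linearD, linearZ) /= (cplxK acsJ); vec; field.
by rewrite memvZ // memvB // memvZ // sU.
Qed.

Definition cplx_ext (U : {vspace g}) x := (U + (<[x]> + <[J x]>))%VS.

Lemma mem_cplx_ext U x v :
  reflect (exists2 u, u \in U & exists m n, v = u + (m *: x + n *: J x))
          (v \in cplx_ext U x).
Proof.
apply: (iffP memv_addP).
  move=> [u uU [_ /memv_addP[_ /vlineP[m ->] [_ /vlineP[n ->] ->]] ->]].
  by exists u => //; exists m, n.
move=> [u uU [m [n ->]]]; exists u => //; exists (m *: x + n *: J x) => //.
by rewrite memv_add // memvZ // memv_line.
Qed.

Lemma cplx_ext_stable U x : cplx_stable U -> cplx_stable (cplx_ext U x).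
Proof.
move=> sU _ /mem_cplx_ext[u uU [m [n ->]]].
apply/mem_cplx_ext; exists (J u); first exact: sU.
by exists (- n), m; rewrite !linearD !linearZ /= (cplxK acsJ); vec.
Qed.

Lemma dim_cplx_ext U x : cplx_stable U -> x \notin U ->
  \dim (cplx_ext U x) = (\dim U + 2)%N.
Proof.
move=> sU xU.
have x0 : x != 0 by apply: contraNneq xU => ->; rewrite mem0v.
have Jx0 : J x != 0.
  by apply: contraNneq x0 => Jx; rewrite -oppr_eq0 -(cplxK acsJ) Jx linear0.
rewrite dimv_disjoint_sum ?dimv_disjoint_sum ?dim_vline ?x0 ?Jx0 //.
- apply/eqP; rewrite -subv0; apply/subvP => v; rewrite memv_cap.
  move=> /andP[/vlineP[m ->] /vlineP[n mn]].
  have x0v : x \notin 0%VS by rewrite memv0.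
  have [|-> _] := @cplx_indep 0%VS x m (- n) stable0 x0v.
    by rewrite mn scaleNr subrr mem0v.
  by rewrite scale0r mem0v.
- apply/eqP; rewrite -subv0; apply/subvP => v; rewrite memv_cap.
  move=> /andP[vU /memv_addP[_ /vlineP[m ->] [_ /vlineP[n ->] Ev]]].
  rewrite Ev in vU *; have [-> ->] := cplx_indep sU xU vU.
  by rewrite !scale0r addr0 mem0v.
Qed.

(** Commutation is tested on a basis only, so that the center is a finite intersection of kernels
    and hence a subspace with a dimension. *)
Definition lie_center : {vspace g} :=
  (\bigcap_(i < \dim (fullv : {vspace g}))
     lker (linfun (HB.pack_for {linear g -> g} (lie_br (vbasis fullv)`_i)
       (GRing.isLinear.Build R g g _ (lie_br (vbasis fullv)`_i)
         (@lie_linearr R g (vbasis fullv)`_i)))))%VS.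

Lemma lie_centerP x : reflect (central x) (x \in lie_center).
Proof.
apply: (iffP idP).
- rewrite memvE => /subv_bigcapP xZ y; rewrite lieC; apply/eqP.
  rewrite oppr_eq0 (coord_vbasis (memvf y)); apply/eqP.
  elim/big_rec: _ => [|i v _ v0]; first by rewrite lie0l.
  have := xZ i isT; rewrite -memvE memv_ker lfunE /= => /eqP xi.
  by rewrite lieE v0 lieE xi scaler0 addr0.
- move=> cx; rewrite memvE; apply/subv_bigcapP => i _.
  by rewrite -memvE memv_ker lfunE /= (centralr _ cx).
Qed.

Lemma center_stable : cplx_stable lie_center.
Proof. by move=> u /lie_centerP /(centralJ acsJ) /lie_centerP. Qed.

End Structure.

(** * Complex independence modulo the center, in dimension six *)

Section Structure6.
Variables (R : realFieldType) (g : lieAlgebra R) (J : 'End(g)).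
Implicit Types (U : {vspace g}) (x y z v w u : g) (m n k l p q s t : R).

Hypothesis acsJ : abelian_complex_structure J.
Hypothesis dim6 : \dim (fullv : {vspace g}) = 6%N.

Definition free_mod_center x y := forall m n k l,
  central (m *: x + n *: J x + (k *: y + l *: J y)) ->
  [/\ m = 0, n = 0, k = 0 & l = 0].

Lemma cplx_indep0 x m n : x != 0 -> m *: x + n *: J x = 0 -> m = 0 /\ n = 0.
Proof.
move=> x0 H; apply: (cplx_indep acsJ (@stable0 _ _ J) (x := x)); rewrite memv0 //.
exact/eqP.
Qed.

(** Modulo the center a relation involves only x, Jx, y, Jy, whose coefficients vanish. What remains
    is a relation between w and z, and after multiplication by q it becomes one between w and Jw. *)
Lemma frame_free x y w z p q : free_mod_center x y -> central w -> w != 0 ->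
  J w = p *: w + q *: z -> q != 0 -> central z ->
  forall c, frame J x y w z c = 0 -> c = 0.
Proof.
move=> fxy cw w0 Jw q0 cz c; rewrite /frame => Hu.
have E : crd c 1 *: x + crd c 2 *: J x + (crd c 3 *: y + crd c 4 *: J y)
    = - (crd c 5 *: w + crd c 6 *: z).
  by apply/eqP; rewrite -addr_eq0 !addrA Hu.
have [|u1 u2 u3 u4] := fxy (crd c 1) (crd c 2) (crd c 3) (crd c 4).
  by rewrite E; apply: centralN; apply: centralD; apply: centralZ.
have : (q * crd c 5 - p * crd c 6) *: w + crd c 6 *: J w = 0.
  rewrite Jw; transitivity (q *: (0 : g)); last by rewrite scaler0.
  by rewrite -Hu u1 u2 u3 u4; vec.
move=> /(cplx_indep0 w0)[u5 u6].
have {}u5 : crd c 5 = 0.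
  by apply: (mulfI q0); rewrite mulr0 -[RHS]u5 u6; ring.
by apply: crdP6; rewrite !crd0.
Qed.

Lemma frame_surj x y w z : (forall c, frame J x y w z c = 0 -> c = 0) ->
  forall v, exists c, v = frame J x y w z c.
Proof.
move=> fr v.
pose L := GRing.isLinear.Build R 'rV[R]_6 g _ _ (frame_is_linear J x y w z).
pose H : {linear 'rV[R]_6 -> g} := HB.pack (frame J x y w z) L.
have [||h _ hK] := @hom_bijective R _ _ (linfun H).
- by move=> u; rewrite lfunE => /fr.
- by rewrite dim6 dimvf.
by exists (h v); rewrite -[LHS]hK lfunE.
Qed.

Lemma free_mod_center_span x y u : free_mod_center x y -> central u -> u != 0 ->
  forall v, exists m n k l s t,
    v = m *: x + n *: J x + (k *: y + l *: J y) + (s *: u + t *: J u).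
Proof.
move=> fxy cu u0 v; have cJu := centralJ acsJ cu.
have [|c ->] := frame_surj (@frame_free x y u (J u) 0 1 fxy cu u0 _ (oner_neq0 _) cJu) v.
  by rewrite scale0r add0r scale1r.
exists (crd c 1), (crd c 2), (crd c 3), (crd c 4), (crd c 5), (crd c 6).
by rewrite /frame !addrA.
Qed.

(** The vectors x, Jx, y, Jy, u, Ju form a basis. Subtracting the u and Ju part from a central v
    leaves a central combination of the other four, which must vanish: the center is a complex
    line. *)
Lemma central_span x y u : free_mod_center x y -> central u -> u != 0 ->
  forall v, central v -> exists s t, v = s *: u + t *: J u.
Proof.
move=> fxy cu u0 v cv; have cJu := centralJ acsJ cu.
have [m [n [k [l [s [t Ev]]]]]] := free_mod_center_span fxy cu u0 v.
have [|m0 n0 k0 l0] := fxy m n k l; last first.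
  by exists s, t; rewrite Ev m0 n0 k0 l0 !scale0r !add0r.
have -> : m *: x + n *: J x + (k *: y + l *: J y) = v - (s *: u + t *: J u).
  by rewrite Ev addrK.
by apply: centralD => //; apply: centralN; apply: centralD; apply: centralZ.
Qed.

Lemma free_mod_center_commuting x y v : free_mod_center x y ->
  (exists2 u : g, central u & u != 0) ->
  [lie v, x] = 0 -> [lie v, J x] = 0 -> [lie v, y] = 0 -> [lie v, J y] = 0 ->
  central v.
Proof.
move=> fxy [u cu u0] h1 h2 h3 h4 t.
have [m [n [k [l [s [r ->]]]]]] := free_mod_center_span fxy cu u0 t.
by rewrite !lieE h1 h2 h3 h4 (centralr _ cu) (centralr _ (centralJ acsJ cu))
  !scaler0 !addr0.
Qed.

Lemma free_mod_centerC x y : free_mod_center x y -> free_mod_center y x.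
Proof.
by move=> fxy m n k l; rewrite addrC => /fxy[].
Qed.

Lemma free_mod_center_rot x y m n : free_mod_center x y -> m ^+ 2 + n ^+ 2 != 0 ->
  free_mod_center (m *: x + n *: J x) y.
Proof.
move=> fxy mn0 a b k l H.
(* These are the real and imaginary parts of (a + ib)(m + in); multiplying back by m - in recovers a
   and b. *)
have [|h1 h2 h3 h4] := fxy (a * m - b * n) (a * n + b * m) k l.
  move: H; congr central; rewrite !(linearD, linearZ) /= (cplxK acsJ).
  by vec.
split=> //.
- apply: (mulfI mn0); rewrite mulr0.
  have -> : (m ^+ 2 + n ^+ 2) * a = m * (a * m - b * n) + n * (a * n + b * m) by ring.
  by rewrite h1 h2 !mulr0 addr0.
- apply: (mulfI mn0); rewrite mulr0.
  have -> : (m ^+ 2 + n ^+ 2) * b = m * (a * n + b * m) - n * (a * m - b * n) by ring.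
  by rewrite h1 h2 !mulr0 subr0.
Qed.

Lemma free_mod_center_add x y m n : free_mod_center x y ->
  free_mod_center (x + (m *: y + n *: J y)) y.
Proof.
move=> fxy a b k l H.
have [|a0 b0 h3 h4] := fxy a b (k + a * m - b * n) (l + a * n + b * m).
  move: H; congr central; rewrite !(linearD, linearZ) /= (cplxK acsJ).
  by vec.
by move: h3 h4; rewrite a0 b0 !mul0r ?subr0 !addr0.
Qed.

Hypothesis nil : lie_nilpotent g.

End Structure6.

(** * Consequences of nilpotency in dimension six *)

Section Nilpotent6.
Variables (R : realFieldType) (g : lieAlgebra R) (J : 'End(g)).
Implicit Types (U : {vspace g}) (x y z v w u : g) (m n k l p q s t : R).

Hypothesis acsJ : abelian_complex_structure J.
Hypothesis dim6 : \dim (fullv : {vspace g}) = 6%N.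
Hypothesis nil : lie_nilpotent g.

Lemma vspace_proper_mem U : U != fullv -> exists v, v \notin U.
Proof.
move=> nU; have /subvPn[v _ vU] : ~~ (fullv <= U)%VS.
  by apply: contra nU => fU; rewrite eqEsubv subvf fU.
by exists v.
Qed.

Lemma center_neq0 : exists2 u : g, central u & u != 0.
Proof.
have [|u u0 uc] := nilpotent_growth (U := 0%VS) nil.
  by apply/eqP => E; move: dim6; rewrite -E dimv0.
exists u; last by rewrite memv0 in u0.
by move=> y; rewrite lieC; have := uc y; rewrite memv0 => /eqP ->; rewrite oppr0.
Qed.

Lemma presentable_center4 : \dim (lie_center g) = 4%N ->
  presentable J (e 6) 0 0 0 0 1.
Proof.
move=> dZ; set Z := lie_center g in dZ.
have sZ : cplx_stable J Z by apply: center_stable.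
have nZ : Z != fullv by apply/eqP => ZE; move: dZ; rewrite ZE dim6.
have [x xZ] := vspace_proper_mem nZ.
have EZ : cplx_ext J Z x = fullv.
  by apply/eqP; rewrite eqEdim subvf dim6 dim_cplx_ext // dZ.
have span v : exists2 u, central u & exists m n, v = u + (m *: x + n *: J x).
  have : v \in cplx_ext J Z x by rewrite EZ memvf.
  by case/mem_cplx_ext => u /lie_centerP cu mn; exists u.
have xJx m n y : central y ->
    [lie x, y + (m *: x + n *: J x)] = n *: [lie x, J x].
  by move=> cy; rewrite !lieE (centralr _ cy) lie_alt scaler0 !add0r.
have JxJx m n y : central y ->
    [lie J x, y + (m *: x + n *: J x)] = - m *: [lie x, J x].
  move=> cy; rewrite !lieE (centralr _ cy) lie_alt lieC scaler0 addr0 add0r.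
  by rewrite scalerN scaleNr.
pose u := [lie x, J x].
(* Nilpotency gives a noncentral v = y + m x + n Jx whose brackets with x and Jx, namely n u and - m
   u, are central. One of m, n is nonzero, so u is central. *)
have cu : central u.
  have [v vZ vc] := nilpotent_growth nil nZ.
  have [y cy [m [n Ev]]] := span v.
  have := vc x; have := vc (J x); rewrite Ev xJx // JxJx // -/u => mu nu.
  apply/lie_centerP; have [n0|n0] := eqVneq n 0; last first.
    by rewrite -[u](scalerK n0) memvZ.
  have [m0|m0] := eqVneq (- m) 0; last first.
    by rewrite -[u](scalerK m0) memvZ.
  case/negP: vZ; rewrite Ev n0; move/eqP: m0; rewrite oppr_eq0 => /eqP ->.
  by rewrite !scale0r !addr0; apply/lie_centerP.
have u0 : u != 0.
  apply: contra xZ => /eqP u0; apply/lie_centerP => v.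
  have [y cy [m [n ->]]] := span v.
  by rewrite xJx // -/u u0 scaler0.
have uZ : u \in Z by apply/lie_centerP.
pose U := cplx_ext J 0%VS u.
have sU : cplx_stable J U by apply/cplx_ext_stable/stable0.
(* The complex line U through u has dimension 2 and the center has dimension 4, so some central y
   lies outside U. *)
have /subvPn[y /lie_centerP cy yU] : ~~ (Z <= U)%VS.
  apply/negP => /dimvS; rewrite dZ dim_cplx_ext ?dimv0 ?memv0 //.
  exact: stable0.
have cJu := centralJ acsJ cu.
(* With w = - Ju and z = u one gets J w = z, and [x, Jx] is the sixth frame vector. *)
exists x, y, (- J u), u; split; rewrite ?(frame0, frame_e) ?cy //.
- move=> c Hc.
  have [c1 c2] : crd c 1 = 0 /\ crd c 2 = 0.
    apply: (cplx_indep acsJ sZ xZ); apply/lie_centerP.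
    have -> : crd c 1 *: x + crd c 2 *: J x = frame J x y (- J u) u c
      - (crd c 3 *: y + crd c 4 *: J y + crd c 5 *: (- J u) + crd c 6 *: u).
      by rewrite /frame; vec.
    rewrite Hc add0r; apply: centralN.
    have cJy := centralJ acsJ cy.
    by do !apply: centralD; apply: centralZ => //; apply: centralN.
  have [c3 c4] : crd c 3 = 0 /\ crd c 4 = 0.
    apply: (cplx_indep acsJ sU yU); apply/mem_cplx_ext; exists 0; rewrite ?mem0v //.
    exists (- crd c 6), (crd c 5).
    transitivity (frame J x y (- J u) u c
       + (- crd c 6 *: u + crd c 5 *: J u)); last by rewrite Hc.
    by rewrite /frame c1 c2; vec.
  have [c6 c5] : crd c 6 = 0 /\ - crd c 5 = 0.
    apply: (cplx_indep0 acsJ u0); rewrite -Hc /frame c1 c2 c3 c4; vec.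
  by move/eqP: c5; rewrite oppr_eq0 => /eqP c5; apply: crdP6; rewrite !crd0.
- exact: centralN.
- by rewrite (centralr _ cy).
- by rewrite (centralr _ (centralJ acsJ cy)).
- by rewrite linearN /= (cplxK acsJ) opprK scale0r scale1r add0r.
Qed.

(** Adjoining x and Jx to the center Z raises the dimension by 2, which cannot give 6, so there is y
    outside. Independence is read first modulo this larger J-stable space and then modulo Z. *)
Lemma free_mod_center_extend x : \dim (lie_center g) != 4%N -> ~ central x ->
  exists y, free_mod_center J x y.
Proof.
move=> dZ ncx; set Z := lie_center g in dZ.
have sZ : cplx_stable J Z by apply: center_stable.
have xZ : x \notin Z by apply/negP => /lie_centerP.
have sE := cplx_ext_stable acsJ (x := x) sZ.
have nE : cplx_ext J Z x != fullv.
  apply/eqP => /(congr1 (fun U => \dim U)); rewrite dim6 dim_cplx_ext // addn2.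
  by case=> d4; rewrite d4 in dZ.
have [y yE] := vspace_proper_mem nE.
exists y => m n k l /lie_centerP cv.
have [k0 l0] : k = 0 /\ l = 0.
  apply: (cplx_indep acsJ sE yE); apply/mem_cplx_ext.
  exists (m *: x + n *: J x + (k *: y + l *: J y)) => //.
  by exists (- m), (- n); vec.
move: cv; rewrite k0 l0 !scale0r !addr0 => cv.
by have [] := cplx_indep acsJ sZ xZ cv.
Qed.

(** This is [nilpotent_growth] at the center: v lies in the second term of the upper central series
    but not in the first. *)
Lemma second_center : ~ lie_abelian g ->
  exists2 v, ~ central v & forall x, central [lie x, v].
Proof.
move=> nab; have nZ : lie_center g != fullv.
  apply/eqP => ZE; apply: nab => x y.
  by have /lie_centerP : x \in lie_center g by rewrite ZE memvf.
have [v vZ vc] := nilpotent_growth nil nZ.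
exists v; first by move/lie_centerP; apply/negP.
by move=> x; apply/lie_centerP.
Qed.

(** Let U be spanned by the center, v and Jv; it is proper. Nilpotency gives y outside U with all
    brackets [t, y] in U. If m and n are the coefficients of y at x and Jx, then [x, y] and [Jx, y]
    are n [x, Jx] and - m [x, Jx] up to central terms, and m, n are not both zero. *)
Lemma lie_xJx_span x v : free_mod_center J x v ->
  central [lie x, v] -> central [lie x, J v] ->
  exists k l u, central u /\ [lie x, J x] = u + (k *: v + l *: J v).
Proof.
move=> fxv cv cJv; set Z := lie_center g.
have sZ : cplx_stable J Z by apply: center_stable.
have mE u m n : central u -> u + (m *: v + n *: J v) \in cplx_ext J Z v.
  by move=> /lie_centerP cu; apply/mem_cplx_ext; exists u => //; exists m, n.
have nE : cplx_ext J Z v != fullv.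
  apply/eqP => EZ; have : x \in cplx_ext J Z v by rewrite EZ memvf.
  case/mem_cplx_ext => u /lie_centerP cu [m [n Ex]].
  have [|/eqP] := fxv 1 0 (- m) (- n); last by rewrite oner_eq0.
  by move: cu; congr central; rewrite Ex; vec.
suff /mem_cplx_ext[u /lie_centerP cu [k [l ->]]] : [lie x, J x] \in cplx_ext J Z v.
  by exists k, l, u.
have [y yE yc] := nilpotent_growth nil nE.
have [u cu u0] := center_neq0.
have [m [n [k [l [s [t Ey]]]]]] := free_mod_center_span acsJ dim6 fxv cu u0 y.
have cJu := centralJ acsJ cu.
have cc s' t' w w' : central w -> central w' -> s' *: w + t' *: w' \in cplx_ext J Z v.
  move=> cw cw'; rewrite -[_ + _]addr0 -[X in _ + X](addr0 0).
  rewrite -{1}(scale0r v) -(scale0r (J v)); apply: mE.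
  by apply: centralD; apply: centralZ.
have [n0|n0] := eqVneq n 0; last first.
  rewrite -[[lie x, J x]](scalerK n0) memvZ //.
  have -> : n *: [lie x, J x] = [lie x, y] - (k *: [lie x, v] + l *: [lie x, J v]).
    rewrite Ey !lieE (centralr _ cu) (centralr _ cJu) lie_alt; vec.
  by apply: memvB; [exact: yc | exact: cc].
have [m0|m0] := eqVneq m 0; last first.
  rewrite -[[lie x, J x]](scalerK m0) memvZ //.
  have -> : m *: [lie x, J x] = (l *: [lie x, v] + - k *: [lie x, J v]) - [lie J x, y].
    rewrite Ey !lieE (centralr _ cu) (centralr _ cJu) !(lieJl acsJ) !(cplxK acsJ).
    by rewrite !lieNr !lie_alt; vec.
  by apply: memvB; [exact: cc | exact: yc].
case/negP: yE; rewrite Ey n0 m0 !scale0r !add0r addrC; apply: mE.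
by apply: centralD; apply: centralZ.
Qed.

End Nilpotent6.

(** * Normal forms *)

Section Normalize.
Variables (R : rcfType) (g : lieAlgebra R) (J : 'End(g)).
Implicit Types (x y z v w u b c : g) (m n k l p q s t : R).

Hypothesis acsJ : abelian_complex_structure J.
Hypothesis dim6 : \dim (fullv : {vspace g}) = 6%N.
Hypothesis nil : lie_nilpotent g.

Lemma presentableI x y w z p q (a b c d : 'rV[R]_6) :
  free_mod_center J x y -> central w -> w != 0 -> q != 0 ->
  J w = p *: w + q *: z ->
  [lie x, J x] = frame J x y w z a -> [lie x, y] = frame J x y w z b ->
  [lie x, J y] = frame J x y w z c -> [lie y, J y] = frame J x y w z d ->
  presentable J a b c d p q.
Proof.
move=> fxy cw w0 q0 Jw xx xy xJ yy; exists x, y, w, z.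
have cz : central z.
  have -> : z = q^-1 *: (J w - p *: w) by rewrite Jw; vec; field.
  apply: centralZ; apply: centralD; first exact: centralJ.
  by apply: centralN; apply: centralZ.
by split=> //; exact: frame_free Jw _ _.
Qed.

Lemma free_noncentral x y : free_mod_center J x y -> ~ central x.
Proof.
move=> fxy cx; have [|/eqP] := fxy 1 0 0 0; last by rewrite oner_eq0.
by rewrite !scale0r scale1r !addr0.
Qed.

Lemma free_scale x y k : free_mod_center J x y -> k != 0 ->
  free_mod_center J x (k *: y).
Proof.
move=> /free_mod_centerC fyx k0; apply: free_mod_centerC.
have -> : k *: y = k *: y + 0 *: J y by rewrite scale0r addr0.
by apply: free_mod_center_rot; rewrite // expr0n addr0 expf_neq0.
Qed.

(** Complex multiplication in disguise: with b = [x, y] and c = [x, Jy], the formal number b + ic is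
    multiplied by m + in, and [x, Jx] by its squared modulus. *)
Lemma rot_lieE x y m n :
  ([lie m *: x + n *: J x, y] = m *: [lie x, y] - n *: [lie x, J y]) *
  ([lie m *: x + n *: J x, J y] = m *: [lie x, J y] + n *: [lie x, y]) *
  ([lie m *: x + n *: J x, J (m *: x + n *: J x)]
     = (m ^+ 2 + n ^+ 2) *: [lie x, J x]).
Proof.
by do !split; rewrite ?(linearD, linearZ) /= ?(cplxK acsJ) !lieE
  ?(lieJJ acsJ) ?(lieJl acsJ) ?(cplxK acsJ) ?lieNr ?lie_alt; vec.
Qed.

(** Expansion of the Hermitian form at x + (m + nJ) y; it is used to complete squares and to build
    isotropic vectors. *)
Lemma add_lieE x y m n :
  ([lie x + (m *: y + n *: J y), y] = [lie x, y] - n *: [lie y, J y]) *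
  ([lie x + (m *: y + n *: J y), J y] = [lie x, J y] + m *: [lie y, J y]) *
  ([lie x + (m *: y + n *: J y), J (x + (m *: y + n *: J y))]
     = [lie x, J x] + (2 * m) *: [lie x, J y] - (2 * n) *: [lie x, y]
       + (m ^+ 2 + n ^+ 2) *: [lie y, J y]).
Proof.
by do !split; rewrite ?(linearD, linearZ) /= ?(cplxK acsJ) !lieE
  ?(lieJJ acsJ) ?(lieJl acsJ) ?(cplxK acsJ) ?lieNr ?lie_alt
  ?(lieC x y) ?(lieJC acsJ x y); vec.
Qed.

Definition indep b c := forall m n, m *: b + n *: c = 0 -> m = 0 /\ n = 0.

Lemma indepP b c : indep b c \/ exists m n, m ^+ 2 + n ^+ 2 != 0 /\ m *: b + n *: c = 0.
Proof.
have [b0|b0] := eqVneq b 0.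
  right; exists 1, 0; rewrite b0 scaler0 scale0r addr0; split=> //.
  by rewrite expr0n addr0 expr1n oner_eq0.
have [/vlineP[k ck]|cb] := boolP (c \in <[b]>%VS).
  right; exists (- k), 1; rewrite ck scale1r scaleNr addNr; split=> //.
  by rewrite expr1n gt_eqF // ltr_wpDl ?sqr_ge0.
left=> m n H; have n0 : n = 0.
  apply/eqP; apply: contraNT cb => n0; apply/vlineP; exists (- (n^-1 * m)).
  have -> : c = n^-1 *: (m *: b + n *: c) + - (n^-1 * m) *: b.
    by vec; field.
  by rewrite H scaler0 add0r.
split=> //; move: H; rewrite n0 scale0r addr0 => /eqP.
by rewrite scaler_eq0 (negPf b0) orbF => /eqP.
Qed.

(* For the inner product making b and c orthonormal, J is antidiagonal in some
   orthonormal basis, and a quarter turn exchanges t and 1/t. *)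
Lemma rotate_cplx b c p q : indep b c -> J b = p *: b + q *: c -> q != 0 ->
  exists m n t, [/\ m ^+ 2 + n ^+ 2 != 0, 0 < `|t| <= 1 &
    J (m *: b - n *: c) = t *: (m *: c + n *: b)].
Proof.
move=> bc Jb q0; pose r := - (q^-1 * (1 + p ^+ 2)).
have Jc : J c = r *: b - p *: c.
  have -> : c = q^-1 *: (J b - p *: b) by rewrite Jb; vec; field.
  rewrite !(linearD, linearN, linearZ) /= (cplxK acsJ) Jb /r; vec; field.
(* J (m b - n c) has coordinates m p - n r and m q + n p on b and c; they are t n and t m for a
   common t exactly when this quadratic form vanishes. Its discriminant S^2 + 4 p^2 is nonnegative,
   which yields the root (S + D) / (2 p) for m / n. *)
have [m [n [mn0 H]]] : exists m n, m ^+ 2 + n ^+ 2 != 0 /\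
    p * m ^+ 2 - (r + q) * m * n - p * n ^+ 2 = 0.
  have [p0|p0] := eqVneq p 0.
    exists 1, 0; rewrite p0; split; last by ring.
    by rewrite expr1n expr0n addr0 oner_eq0.
  pose S := r + q; pose D := Num.sqrt (S ^+ 2 + 4 * p ^+ 2).
  exists (S + D), (2 * p); split.
    by apply: sqr_sum_neq0; right; rewrite mulf_neq0 ?pnatr_eq0.
  have DE : D ^+ 2 = S ^+ 2 + 4 * p ^+ 2.
    by rewrite sqr_sqrtr // addr_ge0 ?sqr_ge0 // pmulr_rge0 ?sqr_ge0 ?ltr0n.
  transitivity (p * (D ^+ 2 - (S ^+ 2 + 4 * p ^+ 2))); last by rewrite DE subrr mulr0.
  by rewrite /S; ring.
(* The orthogonal projection onto (n, m) solves both equations for t at once and avoids a division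
   by m or by n. *)
pose t := ((m * p - n * r) * n + (m * q + n * p) * m) / (m ^+ 2 + n ^+ 2).
have tn : t * n = m * p - n * r.
  rewrite /t; apply: (mulIf mn0); rewrite mulrAC divfK //.
  transitivity ((m * p - n * r) * (m ^+ 2 + n ^+ 2)
    - m * (p * m ^+ 2 - (r + q) * m * n - p * n ^+ 2)); first by ring.
  by rewrite H mulr0 subr0.
have tm : t * m = m * q + n * p.
  rewrite /t; apply: (mulIf mn0); rewrite mulrAC divfK //.
  transitivity ((m * q + n * p) * (m ^+ 2 + n ^+ 2)
    + n * (p * m ^+ 2 - (r + q) * m * n - p * n ^+ 2)); first by ring.
  by rewrite H mulr0 addr0.
have E : J (m *: b - n *: c) = t *: (m *: c + n *: b).
  transitivity ((t * n) *: b + (t * m) *: c); last by vec.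
  by rewrite tn tm linearB !linearZ /= Jb Jc; vec.
have t0 : t != 0.
  apply: contraNneq mn0 => t0; move: E; rewrite t0 scale0r.
  move/(congr1 J); rewrite linear0 (cplxK acsJ) => /eqP.
  rewrite oppr_eq0 -scaleNr => /eqP /bc[-> /eqP]; rewrite oppr_eq0 => /eqP ->.
  by rewrite expr0n addr0.
have [t1|t1] := lerP `|t| 1.
  by exists m, n, t; rewrite normr_gt0 t0.
exists (- n), m, t^-1; split.
- by rewrite sqrrN addrC.
- by rewrite normr_gt0 invr_neq0 //= normfV invf_le1 ?normr_gt0 // ltW.
- have -> : - n *: b - m *: c = - (t^-1 *: (t *: (m *: c + n *: b))) by vec; field.
  rewrite -E linearN linearZ /= (cplxK acsJ); vec.
Qed.

End Normalize.

(** * Reduction to the frame data of a listed pair *)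

Section Classify.
Variables (R : rcfType) (g : lieAlgebra R) (J : 'End(g)).
Implicit Types (x y z v w u b c : g) (m n k l p q s t : R).

Hypothesis acsJ : abelian_complex_structure J.
Hypothesis dim6 : \dim (fullv : {vspace g}) = 6%N.
Hypothesis nil : lie_nilpotent g.

(** The data are those read off the listed pairs above; finding a frame of g with the data of l
    therefore makes g isomorphic to the pair listed under l. *)
Definition presentable_label (l : label R) : Prop :=
  match l with
  | L1 => presentable J (e 6) 0 0 0 0 1
  | L2 b => presentable J (if b then 0 else e 6 : 'rV[R]_6)
      (if b then e 6 else 0 : 'rV[R]_6) 0 (if b then 0 else e 6 : 'rV[R]_6) 0 1
  | L3 s => presentable J (e 5) 0 0 (e 6) s 1
  | L4 t => presentable J 0 (e 5) (e 6) 0 0 t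
  | L5 => presentable J (e 5) (e 6) 0 0 0 1
  | L6 => presentable J (e 4) (e 5) 0 0 0 1
  | L7 t => presentable J (e 4) (e 5) (e 6) 0 0 (- t)
  end.

(** If [x, y] vanished too, y would commute with x, Jx, y and Jy, hence be central. *)
Lemma lie_Jr_neq0 x y : free_mod_center J x y -> [lie y, J y] = 0 ->
  [lie x, J y] = 0 -> [lie x, y] != 0.
Proof.
move=> fxy d0 c0; apply/eqP => b0.
apply: (free_noncentral (free_mod_centerC fxy)).
apply: (free_mod_center_commuting acsJ dim6 fxy (center_neq0 dim6 nil)).
- by rewrite lieC b0 oppr0.
- by rewrite (lieJC acsJ) c0.
- by rewrite lie_alt.
- exact: d0.
Qed.

Lemma classify_3step x y : free_mod_center J x y -> [lie x, J x] = J y ->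
  central [lie x, y] -> central [lie x, J y] ->
  exists2 l, admissible l & presentable_label l.
Proof.
move=> fxy a cb cc.
(* In the Jacobi identity for y, x, Jx the inner brackets [Jx, y] and [y, x] are central, so only
   [y, [x, Jx]] = [y, Jy] survives. *)
have d0 : [lie y, J y] = 0.
  have := lie_jacobi y x (J x).
  rewrite (lieJl acsJ x y) lieNr (centralr _ cc) oppr0 addr0 a.
  by rewrite [X in _ + X](centralr _ _) ?addr0 // lieC; apply: centralN.
(* When x is rotated by m + nJ, y is scaled by m^2 + n^2, which preserves the normalization [x, Jx]
   = Jy. *)
have rotf m n : m ^+ 2 + n ^+ 2 != 0 ->
    free_mod_center J (m *: x + n *: J x) ((m ^+ 2 + n ^+ 2) *: y).
  by move=> mn0; apply: free_scale => //; apply: free_mod_center_rot.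
have rota m n : [lie m *: x + n *: J x, J (m *: x + n *: J x)] =
    J ((m ^+ 2 + n ^+ 2) *: y).
  by rewrite (rot_lieE acsJ x y m n) a linearZ.
have d0' k : [lie k *: y, J (k *: y)] = 0.
  by rewrite linearZ /= !lieE d0 !scaler0.
(* The two coefficients are named in reverse: the relation reads m [x, Jy] + n [x, y] = 0, that is,
   [m x + n Jx, Jy] = 0. *)
have [bc|[n [m [nm0 nmE]]]] := indepP [lie x, y] [lie x, J y]; last first.
  have mn0 : m ^+ 2 + n ^+ 2 != 0 by rewrite addrC.
  have fr := rotf m n mn0; have ra := rota m n.
  set x' := m *: x + n *: J x in fr ra; set y' := _ *: y in fr ra.
  have c'0 : [lie x', J y'] = 0.
    by rewrite /y' linearZ /= lieZr (rot_lieE acsJ x y m n) [m *: _ + _]addrC nmE scaler0.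
  have b'0 := lie_Jr_neq0 fr (d0' _) c'0.
  exists (L6 R) => //.
  apply: (presentableI acsJ fr (w := [lie x', y']) (z := J [lie x', y'])) => //;
    rewrite ?frame0 ?frame_e ?oner_neq0 ?scale0r ?add0r ?scale1r //.
  - rewrite lieZr (rot_lieE acsJ x y m n); apply: centralZ.
    by apply: centralD; [|apply: centralN]; apply: centralZ.
  - exact: d0'.
have b0 : [lie x, y] != 0.
  apply/eqP => b0; have [|/eqP] := bc 1 0; last by rewrite oner_eq0.
  by rewrite b0 scaler0 scale0r addr0.
have [s [t cE]] := central_span acsJ dim6 fxy cb b0 cc.
have t0 : t != 0.
  apply/eqP => t0; have [|_ /eqP] := bc s (-1); last by rewrite oppr_eq0 oner_eq0.
  by rewrite cE t0; vec.
have Jb : J [lie x, y] = (- s / t) *: [lie x, y] + t^-1 *: [lie x, J y].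
  by rewrite cE; vec; field.
have [m [n [r [mn0 r1 JE]]]] := rotate_cplx acsJ bc Jb (invr_neq0 t0).
have fr := rotf m n mn0; have ra := rota m n.
(* After rotation J w = r z with w = [x', y'] and z = [x', Jy'], whereas the data of [L7 t] ask for
   J w = - t z. *)
exists (L7 (- r)); first by rewrite /= normrN.
have r0 : - - r != 0 by rewrite opprK -normr_gt0; case/andP: r1.
set x' := m *: x + n *: J x in fr ra; set y' := _ *: y in fr ra.
have b'E : [lie x', y'] = (m ^+ 2 + n ^+ 2) *: (m *: [lie x, y] - n *: [lie x, J y]).
  by rewrite lieZr (rot_lieE acsJ x y m n).
have c'E : [lie x', J y'] = (m ^+ 2 + n ^+ 2) *: (m *: [lie x, J y] + n *: [lie x, y]).
  by rewrite /y' linearZ /= lieZr (rot_lieE acsJ x y m n).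
apply: (presentableI acsJ fr (w := [lie x', y']) (z := [lie x', J y'])) => //;
    rewrite ?frame0 ?frame_e //.
- rewrite b'E; apply: centralZ.
  by apply: centralD; [|apply: centralN]; apply: centralZ.
- rewrite b'E scaler_eq0 negb_or mn0 /=; apply/eqP => E0.
  move/eqP: E0; rewrite -scaleNr => /eqP /bc[mE nE].
  move/eqP: nE; rewrite oppr_eq0 => /eqP nE.
  by move/eqP: mn0; apply; rewrite mE nE; ring.
- by rewrite b'E linearZ /= JE c'E opprK scale0r add0r; vec.
- exact: d0'.
Qed.

Hypothesis lie2 : forall x y, central [lie x, y].

Lemma classify_isotropic x y : free_mod_center J x y -> [lie y, J y] = 0 ->
  exists2 l, admissible l & presentable_label l.
Proof.
move=> fxy d0.
have [bc|[n [m [nm0 nmE]]]] := indepP [lie x, y] [lie x, J y]; last first.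
  have mn0 : m ^+ 2 + n ^+ 2 != 0 by rewrite addrC.
  have := free_mod_center_rot acsJ fxy mn0.
  have : [lie m *: x + n *: J x, J y] = 0.
    by rewrite (rot_lieE acsJ x y m n) [m *: _ + _]addrC.
  move: (m *: x + n *: J x) => {nmE mn0 nm0 m n fxy} {}x c0 fxy.
  have b0 := lie_Jr_neq0 fxy d0 c0.
  have [s [t aE]] := central_span acsJ dim6 fxy (lie2 x y) b0 (lie2 x (J x)).
  (* Write [x, Jx] = s b + t Jb with b = [x, y]. Adding (s / 2) Jy to x removes s b and, as [y, Jy]
     = [x, Jy] = 0, changes no other bracket; t = 0 gives J_- and t nonzero gives the fifth pair. *)
  have := free_mod_center_add acsJ (m := 0) (n := s / 2) fxy.
  have := add_lieE acsJ x y 0 (s / 2).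
  rewrite d0 c0 !(scaler0, addr0, subr0).
  have -> : [lie x, J x] - (2 * (s / 2)) *: [lie x, y] = t *: J [lie x, y].
    by rewrite aE; vec; field.
  move: (x + _) => x' [[b' c'] a'] fr.
  have [t0|t0] := eqVneq t 0.
    exists (L2 R true) => //.
    apply: (presentableI acsJ fr (w := - J [lie x, y]) (z := [lie x, y])) => //;
      rewrite ?frame0 ?frame_e ?oner_neq0 ?a' ?t0 ?scale0r //.
    - by apply/centralN/centralJ.
    - rewrite oppr_eq0; apply: contraNneq b0 => /(congr1 J).
      by rewrite linear0 (cplxK acsJ) => /eqP; rewrite oppr_eq0.
    - by rewrite linearN /= (cplxK acsJ) opprK add0r scale1r.
  exists (L5 R) => //.
  have fr' : free_mod_center J x' (- t *: y) by apply: free_scale; rewrite ?oppr_eq0.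
  have cb := lie2 x y.
  apply: (presentableI acsJ fr' (w := t *: J [lie x, y]) (z := - t *: [lie x, y])) => //;
    rewrite ?frame0 ?frame_e ?oner_neq0 ?a' ?(linearZ J) /=
      ?lieE ?b' ?c' ?d0 ?scaler0 ?oppr0 //.
  - by apply/centralZ/centralJ.
  - rewrite scaler_eq0 negb_or t0 /=; apply: contraNneq b0 => /(congr1 J).
    by rewrite linear0 (cplxK acsJ) => /eqP; rewrite oppr_eq0.
  - by rewrite linearZ /= (cplxK acsJ); vec.
  - by rewrite linearZ /= lieZr c' scaler0.
  - by rewrite linearZ /= !lieE d0 !scaler0.
have b0 : [lie x, y] != 0.
  apply/eqP => b0; have [|/eqP] := bc 1 0; last by rewrite oner_eq0.
  by rewrite b0 scaler0 scale0r addr0.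
have [s [t cE]] := central_span acsJ dim6 fxy (lie2 x y) b0 (lie2 x (J y)).
have t0 : t != 0.
  apply/eqP => t0; have [|_ /eqP] := bc s (-1); last by rewrite oppr_eq0 oner_eq0.
  by rewrite cE t0; vec.
have Jb : J [lie x, y] = (- s / t) *: [lie x, y] + t^-1 *: [lie x, J y].
  by rewrite cE; vec; field.
have [m [n [r [mn0 r1 JE]]]] := rotate_cplx acsJ bc Jb (invr_neq0 t0).
have b'0 : m *: [lie x, y] - n *: [lie x, J y] != 0.
  apply/eqP => E0; move/eqP: E0; rewrite -scaleNr => /eqP /bc[mE nE].
  move/eqP: nE; rewrite oppr_eq0 => /eqP nE.
  by move/eqP: mn0; apply; rewrite mE nE; ring.
have [a1 [a2 aE]] := central_span acsJ dim6 fxy (lie2 x y) b0 (lie2 x (J x)).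
have {aE} [k [l aE]] : exists k l,
    [lie x, J x] = k *: [lie x, y] + l *: [lie x, J y].
  exists (a1 - a2 * s / t), (a2 / t); rewrite aE Jb; vec; field.
(* Since b and c span the center, [x, Jx] = k b + l c, and this shift of x along y and Jy cancels
   both terms: x becomes isotropic as well. *)
have := free_mod_center_add acsJ (m := - l / 2) (n := k / 2) fxy.
have := add_lieE acsJ x y (- l / 2) (k / 2).
rewrite d0 !(scaler0, addr0, subr0).
have -> : [lie x, J x] + (2 * (- l / 2)) *: [lie x, J y] 
    - (2 * (k / 2)) *: [lie x, y] = 0.
  by rewrite aE; vec; field.
move: (x + _) => x' [[b' c'] a'] fr.
have := free_mod_center_rot acsJ fr mn0.
have := rot_lieE acsJ x' y m n.
rewrite a' b' c' scaler0.
move: (m *: x' + _) => {}x' {b' c' a' fr} [[b' c'] a'] fr.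
have [r0|r0] := ltrP 0 r.
  exists (L4 r).
    by move: r1; rewrite gtr0_norm.
  apply: (presentableI acsJ fr (w := [lie x', y]) (z := [lie x', J y])) => //;
    rewrite ?frame0 ?frame_e ?b' ?c' //.
  - by rewrite gt_eqF.
  - by rewrite JE scale0r add0r.
(* Exchanging x and y changes the sign of [x, y] but not of [x, Jy], which replaces r by - r. *)
exists (L4 (- r)).
  by move: r1; rewrite ler0_norm.
have fr' := free_mod_centerC fr.
apply: (presentableI acsJ fr' (w := [lie y, x']) (z := [lie y, J x'])) => //;
    rewrite ?frame0 ?frame_e //.
- by rewrite lieC b' oppr_eq0.
- by rewrite -normr_gt0 normrN; case/andP: r1.
- by rewrite lieC (lieJC acsJ) b' c' linearN /= JE scale0r add0r scaleNr.
Qed.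

(** * Two-step pairs in which every isotropic vector is central *)

Section Definite.
Hypothesis definite : forall v, [lie v, J v] = 0 -> central v.

Lemma definite_neq0 x y : free_mod_center J x y -> [lie x, J x] != 0.
Proof. by move=> fxy; apply/eqP => /definite; apply: free_noncentral fxy. Qed.

(* When [x, y] and [x, Jy] are not both multiples of a = [x, Jx], the pencil of
   Hermitian forms is indefinite for the determinant, as otherwise there would
   be an isotropic vector; x' and y' below span the kernels of its two members
   of rank one. *)
Lemma definite_diagonal x y : free_mod_center J x y ->
  exists x' y', [/\ free_mod_center J x' y', [lie x', y'] = 0 &
    [lie x', J y'] = 0].
Proof.
move=> fxy; have a0 := definite_neq0 fxy.
have spa := central_span acsJ dim6 fxy (lie2 x (J x)) a0.
have [s1 [t1 b]] := spa _ (lie2 x y).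
have [s2 [t2 c]] := spa _ (lie2 x (J y)).
(* If [x, y] and [x, Jy] are multiples of a, Gram-Schmidt with x makes y orthogonal to x. *)
have [tt0|t12] := eqVneq (t1 ^+ 2 + t2 ^+ 2) 0.
  have [t10 t20] := sqr_sum_eq0 tt0.
  exists (y + (- s2 *: x + - s1 *: J x)), x; split.
  - by apply: free_mod_center_add => //; apply: free_mod_centerC.
  - by rewrite (add_lieE acsJ y x (- s2) (- s1)) lieC b t10; vec.
  - by rewrite (add_lieE acsJ y x (- s2) (- s1)) (lieJC acsJ) c t20; vec.
have fyx := free_mod_centerC fxy.
have t21 : t2 ^+ 2 + (- t1) ^+ 2 != 0 by rewrite sqrrN addrC.
(* Replacing y by t2 y - t1 Jy cancels the Ja component of [y, x], leaving [nu] times a. *)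
have := free_mod_center_rot acsJ fyx t21.
have := rot_lieE acsJ y x t2 (- t1).
rewrite (lieC x y) (lieJC acsJ x y).
move: (t2 *: y + _) => y1 [[b1 c1] _] fyx1.
have [s3 [t3 d]] := spa _ (lie2 y1 (J y1)).
have t210 : t2 ^+ 2 + t1 ^+ 2 != 0 by rewrite addrC.
(* Adding (mu + nu J) x to y1 then makes [y2, x] vanish by the choice of [nu], and cancels the Ja
   component of [y2, J y2] by the choice of [mu]. *)
pose mu := - t3 / (2 * (t2 ^+ 2 + t1 ^+ 2)); pose nu := s2 * t1 - s1 * t2.
have := free_mod_center_add acsJ (m := mu) (n := nu) fyx1.
have := add_lieE acsJ y1 x mu nu.
rewrite b1 c1 d b c.
move: (y1 + _) => y2 [[b2 _] d2] fyx2.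
pose a := [lie x, J x].
have {}b2 : [lie x, y2] = 0 by rewrite lieC b2 /nu; vec.
have [del {}d2] : exists del, [lie y2, J y2] = del *: a.
  exists (s3 + 2 * mu * (s2 * t2 + s1 * t1) + mu ^+ 2 - nu ^+ 2).
  by rewrite d2 /mu /nu; vec; field; rewrite t210.
(* A negative [del] would make x + eta J y2 isotropic, and [del] = 0 would make y2 isotropic; both
   are noncentral. *)
have [del0|del0|del0] := ltrgt0P del; last 2 first.
- pose eta := Num.sqrt (- del^-1).
  have sq : eta ^+ 2 = - del^-1 by rewrite sqr_sqrtr // oppr_ge0 invr_le0 ltW.
  case: (free_noncentral (free_mod_center_add acsJ (m := 0) (n := eta)
    (free_mod_centerC fyx2))).
  apply: definite; rewrite (add_lieE acsJ x y2 0 eta) b2 d2 sq -/a.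
  by vec; field; rewrite lt_eqF.
- by have := definite_neq0 fyx2; rewrite d2 del0 scale0r eqxx.
pose sig := Num.sqrt del.
have sig0 : sig != 0 by rewrite sqrtr_eq0 -ltNge.
have sq : sig ^+ 2 = del by rewrite sqr_sqrtr // ltW.
(* The form a-component of y2 is sig^2 times that of x, and [x, J y2] is symmetric in x and y2, so
   both brackets of the sum with the difference cancel. *)
exists (y2 + sig *: x), (y2 - sig *: x); split.
- move=> m n k l H.
  have [|h1 h2 h3 h4] := fyx2 (m + k) (n + l) (sig * (m - k)) (sig * (n - l)).
    by move: H; congr central; rewrite linearB linearD !linearZ /=; vec.
  move: h3 h4 => /eqP; rewrite mulf_eq0 (negPf sig0) /= => /eqP h3.
  move=> /eqP; rewrite mulf_eq0 (negPf sig0) /= => /eqP h4.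
  by split; lra.
- by rewrite !lieE !lie_alt (lieC x y2) b2; vec.
- rewrite linearB linearZ /= !lieE d2 (lieJC acsJ x y2) -/a -sq.
  by vec.
Qed.

(** Scaling y by the square root of q multiplies [y, Jy] by q, which turns the coefficient q into 1;
    this is where the sign of q matters. *)
Lemma presentable_L3 x y p q : free_mod_center J x y ->
  [lie x, y] = 0 -> [lie x, J y] = 0 -> 0 < q ->
  J [lie x, J x] = p *: [lie x, J x] + q *: [lie y, J y] ->
  presentable_label (L3 p).
Proof.
move=> fxy b0 c0 q0 Ja; pose k := Num.sqrt q.
have k0 : k != 0 by rewrite sqrtr_eq0 -ltNge.
have kk : k ^+ 2 = q by rewrite sqr_sqrtr // ltW.
have dE : [lie k *: y, J (k *: y)] = q *: [lie y, J y].
  by rewrite linearZ /= !lieE -kk; vec.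
apply: (presentableI acsJ (free_scale acsJ fxy k0) (w := [lie x, J x])
    (z := q *: [lie y, J y]));
  rewrite ?frame0 ?frame_e ?oner_neq0 ?dE //.
- exact: definite_neq0 fxy.
- by rewrite Ja; vec.
- by rewrite lieZr b0 scaler0.
- by rewrite linearZ /= lieZr c0 scaler0.
Qed.

Lemma classify_definite x y : free_mod_center J x y ->
  exists2 l, admissible l & presentable_label l.
Proof.
move=> /definite_diagonal[{}x [{}y [fxy b0 c0]]].
have fyx := free_mod_centerC fxy.
have a0 := definite_neq0 fxy; have ca := lie2 x (J x).
have [s [t d]] := central_span acsJ dim6 fxy ca a0 (lie2 y (J y)).
have b'0 : [lie y, x] = 0 by rewrite lieC b0 oppr0.
have c'0 : [lie y, J x] = 0 by rewrite (lieJC acsJ).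
have [t0|t0|t0] := ltrgt0P t.
- exists (L3 (- s / t)) => //.
  apply: (presentable_L3 fxy b0 c0 (q := t^-1)); first by rewrite invr_gt0.
  by rewrite d; vec; field; rewrite gt_eqF.
(* For t < 0 the roles of x and y are exchanged. Eliminating Ja from J d = s Ja - t a gives J d = (s
   / t) d - (s^2 / t + t) a, whose last coefficient is positive. *)
- exists (L3 (s / t)) => //.
  apply: (presentable_L3 fyx b'0 c'0 (q := - (s ^+ 2 / t + t))).
    rewrite oppr_gt0 -[X in _ / t + X](mulfK (ltr0_neq0 t0)) -mulrDl.
    by rewrite nmulr_llt0 ?invr_lt0 // -expr2 ltr_wpDl ?sqr_ge0 //
      exprn_even_gt0 //= ltr0_neq0.
  rewrite d linearD !linearZ /= (cplxK acsJ); vec.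
  by field; rewrite lt_eqF.
(* Now [y, Jy] = s [x, Jx]. For s < 0 the vector x + k y with k^2 = - 1 / s would be isotropic, and
   for s = 0 so would y. *)
- have s0 : 0 < s.
    rewrite ltNge; apply/negP => s0.
    have dn0 := definite_neq0 fyx.
    have {}s0 : s < 0.
      rewrite lt_neqAle s0 andbT; apply: contraNneq dn0 => s0'.
      by rewrite d s0' t0 !scale0r addr0.
    pose k := Num.sqrt (- s^-1).
    have kk : k ^+ 2 = - s^-1 by rewrite sqr_sqrtr // oppr_ge0 invr_le0 ltW.
    case: (free_noncentral (free_mod_center_add acsJ (m := k) (n := 0) fxy)).
    apply: definite; rewrite (add_lieE acsJ x y k 0) b0 c0 d t0 kk.
    by vec; field; rewrite lt_eqF.
  pose k := Num.sqrt s^-1.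
  have k0 : k != 0 by rewrite sqrtr_eq0 -ltNge invr_gt0.
  have kk : k ^+ 2 = s^-1 by rewrite sqr_sqrtr // invr_ge0 ltW.
  exists (L2 R false) => //.
  apply: (presentableI acsJ (free_scale acsJ fxy k0) (w := - J [lie x, J x])
      (z := [lie x, J x])) => //;
    rewrite ?frame0 ?frame_e ?oner_neq0 ?scale0r ?add0r ?scale1r //.
  + by apply/centralN/centralJ.
  + rewrite oppr_eq0; apply: contraNneq a0 => /(congr1 J).
    by rewrite linear0 (cplxK acsJ) => /eqP; rewrite oppr_eq0.
  + by rewrite linearN /= (cplxK acsJ) opprK.
  + by rewrite lieZr b0 scaler0.
  + by rewrite linearZ /= lieZr c0 scaler0.
  + rewrite linearZ /= !lieE d t0 scale0r addr0 !scalerA -expr2 kk mulVf ?scale1r //.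
    by rewrite gt_eqF.
Qed.

End Definite.

End Classify.

(** * Every pair is isomorphic to a listed one *)

Section Existence.
Variable R : rcfType.
Implicit Types (l : label R).

Lemma free_central_shift (g : lieAlgebra R) (J : 'End(g)) (x y u : g) :
  abelian_complex_structure J -> free_mod_center J x y -> central u ->
  free_mod_center J x (y + u).
Proof.
move=> acsJ fxy cu m n k l H; apply: fxy.
have -> : m *: x + n *: J x + (k *: y + l *: J y) =
   (m *: x + n *: J x + (k *: (y + u) + l *: J (y + u))) - (k *: u + l *: J u).
  by rewrite linearD /=; vec.
have cJu := centralJ acsJ cu.
by apply: centralD => //; apply: centralN; apply: centralD; apply: centralZ.
Qed.

Lemma lie_frame_central (g : lieAlgebra R) (J : 'End(g)) (x y : g) :
  abelian_complex_structure J -> \dim (fullv : {vspace g}) = 6%N ->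
  lie_nilpotent g -> free_mod_center J x y ->
  central [lie x, J x] -> central [lie x, y] -> central [lie x, J y] ->
  central [lie y, J y] -> forall u v : g, central [lie u, v].
Proof.
move=> acsJ dim6 nil fxy ca cb cc cd u v.
have [w cw w0] := center_neq0 dim6 nil; have cJw := centralJ acsJ cw.
have Jw : J w = 0 *: w + 1 *: J w by rewrite scale0r add0r scale1r.
have fs := frame_surj dim6 (frame_free acsJ fxy cw w0 Jw (oner_neq0 _) cJw).
have [c ->] := fs u; have [d ->] := fs v.
by rewrite (frame_lie acsJ) //; do !apply: centralD; apply: centralZ.
Qed.

Lemma exists_presentable_label (g : lieAlgebra R) (J : 'End(g)) :
  \dim (fullv : {vspace g}) = 6%N -> lie_nilpotent g -> ~ lie_abelian g ->
  abelian_complex_structure J ->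
  exists2 l : label R, admissible l & presentable_label J l.
Proof.
move=> dim6 nil nab acsJ.
have [d4|d4] := eqVneq (\dim (lie_center g)) 4%N.
  by exists (L1 R) => //; exact: presentable_center4.
have [v ncv cv] := second_center nil nab.
have [x /free_mod_centerC fxv] := free_mod_center_extend acsJ dim6 d4 ncv.
have cvJ y : central [lie y, J v].
  by rewrite -(opprK [lie y, J v]) -(lieJl acsJ); apply: centralN.
have [k [l [u [cu aE]]]] := lie_xJx_span acsJ dim6 nil fxv (cv x) (cvJ x).
(* Here [x, Jx] = u + k v + l Jv with u central. All other brackets of x, Jx, v, Jv are central, so
   k = l = 0 makes g two-step. *)
have [kl0|kl0] := eqVneq (k ^+ 2 + l ^+ 2) 0.
  have [k0 l0] := sqr_sum_eq0 kl0.
  have ca : central [lie x, J x] by rewrite aE k0 l0 !scale0r !addr0.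
  have lie2 := lie_frame_central acsJ dim6 nil fxv ca (cv x) (cvJ x) (cvJ v).
  have [[w [ncw w0]]|def] := EM (exists w : g, ~ central w /\ [lie w, J w] = 0).
    have [y /free_mod_centerC fyw] := free_mod_center_extend acsJ dim6 d4 ncw.
    exact: (classify_isotropic acsJ dim6 nil lie2 fyw w0).
  apply: (classify_definite acsJ dim6 lie2 _ fxv) => w w0.
  by apply: contrapT => ncw; apply: def; exists w.
(* This is - J [x, Jx], chosen so that Jy = [x, Jx]. *)
pose y := (l *: v + - k *: J v) + - J u.
have Jy : J y = [lie x, J x].
  by rewrite aE /y !(linearD, linearN, linearZ) /= !(cplxK acsJ); vec.
have fxy : free_mod_center J x y.
  apply: free_central_shift => //; last by apply/centralN/centralJ.
  apply: free_mod_centerC; apply: free_mod_center_rot => //.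
    exact: free_mod_centerC.
  by rewrite sqrrN addrC.
have clin m n : central [lie x, m *: v + n *: J v].
  by rewrite !lieE; apply: centralD; apply: centralZ.
apply: (classify_3step acsJ dim6 nil fxy) => //.
- by rewrite /y lieDr lieNr (centralr _ (centralJ acsJ cu)) oppr0 addr0.
- by rewrite Jy aE lieDr (centralr _ cu) add0r.
Qed.

Lemma dim_listed l : \dim (fullv : {vspace pair_lie (listed_pair l)}) = 6%N.
Proof. by case: l => *; rewrite dimvf. Qed.

Lemma presentable_listed l : presentable_label (pair_J (listed_pair l)) l.
Proof.
case: l => [|b|s|t| | |t].
- exact: presentable1.
- exact: presentable2.
- exact: presentable3.
- exact: presentable4.
- exact: presentable5.
- exact: presentable6.
- exact: presentable7.
Qed.

Lemma exists_listed_pair (g : lieAlgebra R) (J : 'End(g)) :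
  \dim (fullv : {vspace g}) = 6%N -> lie_nilpotent g -> ~ lie_abelian g ->
  abelian_complex_structure J ->
  exists2 l : label R, admissible l &
    holomorphically_isomorphic (LiePair J) (listed_pair l).
Proof.
move=> dim6 nil nab acsJ.
have [l al pl] := exists_presentable_label dim6 nil nab acsJ; exists l => //.
have pQ := presentable_listed l; have acsQ := listed_pair_complex al.
have iso a b c d p q : q != 0 -> presentable J a b c d p q ->
    presentable (pair_J (listed_pair l)) a b c d p q ->
    holomorphically_isomorphic (LiePair J) (listed_pair l).
  move=> q0 pP; apply: (@presentable_holo _ (LiePair J) _ dim6 _ acsJ acsQ
    _ _ _ _ _ _ q0 pP); exact: dim_listed.
case: l al pl pQ acsQ iso => [|b|s|t| | |t] al pl pQ _ /(_ _ _ _ _ _ _ _ pl pQ);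
  apply; rewrite ?oner_neq0 //.
- by case/andP: al => /lt0r_neq0.
- by case/andP: al; rewrite normr_gt0 oppr_eq0.
Qed.

End Existence.

(** * Invariants of the listed pairs *)

Section SameFamily.
Variable R : realFieldType.
Implicit Types (s t : R).

(** Let X, X' and Y, Y' be the squared lengths of f e1 and f e3 in the planes (e1, e2) and (e3, e4).
    Then f e5 = X e5 + X' e6 and f e6 = Y e5 + Y' e6. Orthogonality gives X Y = X' Y' = 0; comparing
    J on f e5 excludes X = 0, so Y = X' = 0 and s = s'. *)
Lemma listed_L3_inj s s' :
  holomorphically_isomorphic (listed_pair (L3 s)) (listed_pair (L3 s')) -> s = s'.
Proof.
move=> [f [[h fK _] fl fJ]]; have f0 u : f u = 0 -> u = 0.
  by move=> fu; rewrite -[u]fK fu -{1}(linear0 f) fK.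
pose x : 'rV[R]_6 := f (e 1); pose y : 'rV[R]_6 := f (e 3).
have fJx : f (e 2) = J3 s' x.
  by rewrite [RHS]fJ; congr (f _); apply: crdP6; rewrite !J3_crd ?crd_e //=; split; ring.
have fJy : f (e 4) = J3 s' y.
  by rewrite [RHS]fJ; congr (f _); apply: crdP6; rewrite !J3_crd ?crd_e //=; split; ring.
have f5 : f (e 5) = table_br (T3 R) x (J3 s' x).
  rewrite -fJx -[RHS]fl; congr (f _).
  by apply: crdP6; rewrite /lie_br /= !T3_crd ?crd_e //=; split; ring.
have f6 : f (e 6) = table_br (T3 R) y (J3 s' y).
  rewrite -fJy -[RHS]fl; congr (f _).
  by apply: crdP6; rewrite /lie_br /= !T3_crd ?crd_e //=; split; ring.
have xy : table_br (T3 R) x y = 0.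
  rewrite -(linear0 f) -[LHS]fl; congr (f _).
  by apply: crdP6; rewrite /lie_br /= !T3_crd ?crd_e ?crd0 //=; split; ring.
have xJy : table_br (T3 R) x (J3 s' y) = 0.
  rewrite -fJy -(linear0 f) -[LHS]fl; congr (f _).
  by apply: crdP6; rewrite /lie_br /= !T3_crd ?crd_e ?crd0 //=; split; ring.
have J5 : J3 s' (f (e 5)) = s *: f (e 5) + f (e 6).
  rewrite -linearZ -linearD [LHS]fJ; congr (f _).
  by apply: crdP6; rewrite !J3_crd ?crdE ?crd_e //=; split; ring.
have e0 k : (0 < k <= 6)%N -> (e k : 'rV[R]_6) = 0 -> False.
  move=> kP /(congr1 (fun v => crd v k)); rewrite crd_e // eqxx crd0.
  by apply/eqP/oner_neq0.
have := congr1 (fun v => crd v 5) xy; have := congr1 (fun v => crd v 6) xy.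
have := congr1 (fun v => crd v 5) xJy; have := congr1 (fun v => crd v 6) xJy.
have := congr1 (fun v => crd v 5) J5; have := congr1 (fun v => crd v 6) J5.
rewrite /= !J3_crd !crdE f5 f6 !T3_crd !J3_crd.
move=> K6 K5 h4 h3 h2 h1.
pose X := crd x 1 ^+ 2 + crd x 2 ^+ 2; pose X' := crd x 3 ^+ 2 + crd x 4 ^+ 2.
pose Y := crd y 1 ^+ 2 + crd y 2 ^+ 2; pose Y' := crd y 3 ^+ 2 + crd y 4 ^+ 2.
have XY : X * Y = 0.
  transitivity ((crd x 1 * crd y 2 - crd x 2 * crd y 1) ^+ 2 +
     (crd x 1 * crd y 1 - crd x 2 * - crd y 2) ^+ 2).
    by rewrite /X /Y; ring.
  by rewrite h1 h3 expr0n addr0.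
have XY' : X' * Y' = 0.
  transitivity ((crd x 3 * crd y 4 - crd x 4 * crd y 3) ^+ 2 +
     (crd x 3 * crd y 3 - crd x 4 * - crd y 4) ^+ 2).
    by rewrite /X' /Y'; ring.
  by rewrite h2 h4 expr0n addr0.
have {}K5 : s' * X - (1 + s' ^+ 2) * X' = s * X + Y.
  by rewrite /X /X' /Y; move: K5 => /eqP; rewrite -subr_eq0 => /eqP K5; apply/eqP;
     rewrite -subr_eq0 -K5; apply/eqP; ring.
have {}K6 : X - s' * X' = s * X' + Y'.
  by rewrite /X /X' /Y'; move: K6 => /eqP; rewrite -subr_eq0 => /eqP K6; apply/eqP;
     rewrite -subr_eq0 -K6; apply/eqP; ring.
have X'0 : 0 <= X' by rewrite addr_ge0 ?sqr_ge0.
have Y0 : 0 <= Y by rewrite addr_ge0 ?sqr_ge0.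
have XX0 : X = 0 -> X' = 0 -> False.
  move=> x0 x'0; apply: (e0 5%N isT); apply: f0; rewrite f5.
  apply: crdP6; rewrite !T3_crd ?J3_crd !crd0; split=> //.
    by rewrite -[RHS]x0 /X; ring.
  by rewrite -[RHS]x'0 /X'; ring.
have YY0 : Y = 0 -> Y' = 0 -> False.
  move=> y0 y'0; apply: (e0 6%N isT); apply: f0; rewrite f6.
  apply: crdP6; rewrite !T3_crd ?J3_crd !crd0; split=> //.
    by rewrite -[RHS]y0 /Y; ring.
  by rewrite -[RHS]y'0 /Y'; ring.
(* If X = 0, then - (1 + s'^2) X' = Y with both X' and Y nonnegative, so f e5 would vanish. *)
move/eqP: XY; rewrite mulf_eq0 => /orP[/eqP x0|/eqP y0].
  have x'0 : X' = 0.
    apply/eqP; rewrite eq_le X'0 andbT leNgt; apply/negP => X'p.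
    have : 0 < (1 + s' ^+ 2) * X' by rewrite mulr_gt0 // ltr_pwDl ?sqr_ge0.
    by move: K5; rewrite x0 !mulr0 => K5; lra.
  by case: XX0.
move/eqP: XY'; rewrite mulf_eq0 => /orP[/eqP x'0|/eqP y'0]; last by case: YY0.
have x0 : X != 0 by apply/eqP => x0; apply: XX0.
by move: K5; rewrite x'0 y0 mulr0 subr0 addr0 => /(mulIf x0).
Qed.

(** Both numbers have absolute value 1 and the same sign. This is why the parameters are cut off at
    1: t and 1/t give isomorphic pairs. *)
Lemma le1_of_inv t t' : `|t| <= 1 -> `|t'| <= 1 -> t * t' = 1 -> t = t'.
Proof.
rewrite !ler_norml => /andP[? ?] /andP[? ?] tt'; nra.
Qed.

(** Modulo the center the isotropic vectors form two complex lines, represented by e1 + e4 and e2 +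
    e3. An isomorphism preserves or exchanges them, and J on the center then relates t and t'. *)
Lemma listed_L4_inj t t' : 0 < t <= 1 -> 0 < t' <= 1 ->
  holomorphically_isomorphic (listed_pair (L4 t)) (listed_pair (L4 t')) -> t = t'.
Proof.
move=> /andP[t0 t1] /andP[t'0 t'1] [f [[h fK _] fl fJ]].
have f0 u : f u = 0 -> u = 0.
  by move=> fu; rewrite -[u]fK fu -{1}(linear0 f) fK.
have t'n : t' != 0 by rewrite gt_eqF.
pose p : 'rV[R]_6 := e 1 + e 4; pose q : 'rV[R]_6 := e 2 + e 3.
pose x : 'rV[R]_6 := f p; pose y : 'rV[R]_6 := f q.
have xx : table_br (T4 R) x (J4 t' x) = 0.
  rewrite [J4 _ _]fJ -(linear0 f) -[LHS]fl; congr (f _).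
  by apply: crdP6; rewrite /lie_br /= !T4_crd ?J4_crd ?crdE ?crd_e //=; split; ring.
have yy : table_br (T4 R) y (J4 t' y) = 0.
  rewrite [J4 _ _]fJ -(linear0 f) -[LHS]fl; congr (f _).
  by apply: crdP6; rewrite /lie_br /= !T4_crd ?J4_crd ?crdE ?crd_e //=; split; ring.
have f5 : f (2 *: e 5) = table_br (T4 R) x y.
  rewrite -[RHS]fl; congr (f _).
  by apply: crdP6; rewrite /lie_br /= !T4_crd ?crdE ?crd_e //=; split; ring.
have f6 : f (2 *: e 6) = table_br (T4 R) x (J4 t' y).
  rewrite [J4 _ _]fJ -[RHS]fl; congr (f _).
  by apply: crdP6; rewrite /lie_br /= !T4_crd ?J4_crd ?crdE ?crd_e //=; split; ring.
have J5 : J4 t' (f (2 *: e 5)) = t *: f (2 *: e 6).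
  rewrite -linearZ [LHS]fJ; congr (f _).
  by apply: crdP6; rewrite !J4_crd ?crdE ?crd_e //=; split; ring.
have iso z : table_br (T4 R) z (J4 t' z) = 0 ->
    crd z 2 = - crd z 3 /\ crd z 4 = crd z 1 \/
    crd z 2 = crd z 3 /\ crd z 4 = - crd z 1.
  move=> zz; have := congr1 (fun v => crd v 5) zz; have := congr1 (fun v => crd v 6) zz.
  rewrite /= !T4_crd !J4_crd !crdE => z6 z5.
  (* The sum of the squares of the two coordinates of [z, Jz] factors into two sums of squares, one
     for each isotropic line. *)
  have : ((crd z 1 - crd z 4) ^+ 2 + (crd z 2 + crd z 3) ^+ 2) *
     ((crd z 1 + crd z 4) ^+ 2 + (crd z 2 - crd z 3) ^+ 2) = 0.
    transitivity ((crd z 1 * crd z 1 - crd z 3 * - crd z 3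
         - (crd z 2 * crd z 2 - crd z 4 * - crd z 4)) ^+ 2
       + (crd z 1 * crd z 2 - crd z 4 * - crd z 3
         + (crd z 2 * crd z 1 - crd z 3 * - crd z 4)) ^+ 2).
      by ring.
    by rewrite z5 z6 expr0n addr0.
  move/eqP; rewrite mulf_eq0 => /orP[] /eqP /sqr_sum_eq0[E1 E2]; [left|right];
    by split; lra.
have fe5 : table_br (T4 R) x y <> 0.
  rewrite -f5 => /f0 /(congr1 (fun v => crd v 5)).
  by rewrite !crdE crd_e //= => /eqP; rewrite mulr1 pnatr_eq0.
have := congr1 (fun v => crd v 5) J5; have := congr1 (fun v => crd v 6) J5.
rewrite /= !J4_crd !crdE f5 f6 !T4_crd !J4_crd.
(* When x and y lie on different isotropic lines, A and B are up to sign the coordinates of [x, y],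
   so they are not both zero. *)
pose A := 2 * (crd x 1 * crd y 3 - crd x 3 * crd y 1).
pose B := 2 * (crd x 1 * crd y 1 + crd x 3 * crd y 3).
have neq0 c d : crd (table_br (T4 R) x y) 5 = c -> crd (table_br (T4 R) x y) 6 = d ->
    c = 0 -> d = 0 -> False.
  move=> cE dE c0 d0; apply: fe5; apply: crdP6;
    by rewrite ?cE ?dE ?c0 ?d0 ?T4_crd !crd0; split.
have {neq0} := neq0 _ _ erefl erefl; rewrite !T4_crd.
case: (iso x xx) => -[-> ->]; case: (iso y yy) => -[-> ->] neq0.
- by case: neq0; ring.
- move=> K6 K5.
  have {}K6 : A * (t' - t) = 0.
    by rewrite /A; move/eqP: K6; rewrite -subr_eq0 => /eqP <-; ring.
  have {}K5 : B * (t * t' - 1) = 0.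
    move/(congr1 (fun u => u * - t')): K5 => /eqP; rewrite -subr_eq0 => /eqP <-.
    by rewrite /B; field.
  move/eqP: K6; rewrite mulf_eq0 => /orP[/eqP A0|]; last first.
    by rewrite subr_eq0 eq_sym => /eqP.
  move/eqP: K5; rewrite mulf_eq0 => /orP[/eqP B0|].
    by case: neq0; [rewrite -A0 /A|rewrite -[RHS]oppr0 -B0 /B]; ring.
  rewrite subr_eq0 => /eqP tt'.
  by apply: le1_of_inv; rewrite ?gtr0_norm.
(* The lines are exchanged: this would force t' = - t or t t' = - 1, against positivity. *)
- move=> K6 K5; exfalso.
  have {}K6 : A * (t' + t) = 0.
    by rewrite /A; move/eqP: K6; rewrite -subr_eq0 => /eqP <-; ring.
  have {}K5 : B * (t * t' + 1) = 0.
    move/(congr1 (fun u => u * - t')): K5 => /eqP; rewrite -subr_eq0 => /eqP <-.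
    by rewrite /B; field.
  move/eqP: K6; rewrite mulf_eq0 => /orP[/eqP A0|]; last by rewrite gt_eqF // addr_gt0.
  move/eqP: K5; rewrite mulf_eq0 => /orP[/eqP B0|]; last first.
    by rewrite gt_eqF // addr_gt0 ?mulr_gt0.
  by case: neq0; [rewrite -A0 /A|rewrite -B0 /B]; ring.
- by case: neq0; ring.
Qed.

(** The vector x = f e1 determines f e3, f e4, f e5 and f e6. Comparing J on f e5 yields x1 (t' - t)
    = 0 and x2 (t t' - 1) = 0, where x1 and x2 are not both zero. *)
Lemma listed_L7_inj t t' : 0 < `|t| <= 1 -> 0 < `|t'| <= 1 ->
  holomorphically_isomorphic (listed_pair (L7 t)) (listed_pair (L7 t')) -> t = t'.
Proof.
move=> /andP[t0 t1] /andP[t'0 t'1] [f [[h fK _] fl fJ]].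
have f0 u : f u = 0 -> u = 0.
  by move=> fu; rewrite -[u]fK fu -{1}(linear0 f) fK.
have t'n : t' != 0 by rewrite -normr_gt0.
pose x : 'rV[R]_6 := f (e 1); pose w : 'rV[R]_6 := table_br (T7 R) x (J7 t' x).
have f4 : f (e 4) = w.
  rewrite /w [J7 _ _]fJ -[RHS]fl; congr (f _).
  by apply: crdP6; rewrite /lie_br /= !T7_crd ?J7_crd ?crdE ?crd_e //=; split; ring.
have f3 : f (e 3) = J7 t' w.
  rewrite -f4 [RHS]fJ; congr (f _).
  by apply: crdP6; rewrite !J7_crd ?crdE ?crd_e //=; split; ring.
have f5 : f (e 5) = table_br (T7 R) x (J7 t' w).
  rewrite -f3 -[RHS]fl; congr (f _).
  by apply: crdP6; rewrite /lie_br /= !T7_crd ?crdE ?crd_e //=; split; ring.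
have f6 : f (e 6) = table_br (T7 R) x w.
  rewrite -f4 -[RHS]fl; congr (f _).
  by apply: crdP6; rewrite /lie_br /= !T7_crd ?crdE ?crd_e //=; split; ring.
have J5 : J7 t' (f (e 5)) = t *: f (e 6).
  rewrite -linearZ [LHS]fJ; congr (f _).
  by apply: crdP6; rewrite !J7_crd ?crdE ?crd_e //=; split; ring.
pose rho := crd x 1 ^+ 2 + crd x 2 ^+ 2.
have [w1 w2 w3] : [/\ crd w 1 = 0, crd w 2 = 0 & crd w 3 = 0].
  by rewrite /w !T7_crd.
have w4 : crd w 4 = rho by rewrite /w !T7_crd !J7_crd /rho; ring.
have := congr1 (fun v => crd v 5) J5; have := congr1 (fun v => crd v 6) J5.
rewrite /= !J7_crd !crdE f5 f6 !T7_crd !J7_crd !(w1, w2, w3, w4).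
have rho0 : rho != 0.
  apply/eqP => rho0; have [x1 x2] := sqr_sum_eq0 rho0.
  have /f0 /(congr1 (fun v => crd v 5)) : f (e 5) = 0.
    rewrite f5; apply: crdP6; rewrite !T7_crd ?J7_crd ?(w1, w2, w3, w4) ?rho0
      ?x1 ?x2 !crd0;
      split; ring.
  by rewrite crd_e // crd0 => /eqP; rewrite oner_eq0.
move=> K6 K5.
have {}K6 : rho * (crd x 1 * (t' - t)) = 0.
  by move/eqP: K6; rewrite -subr_eq0 => /eqP <-; rewrite /rho; ring.
have {}K5 : rho * (crd x 2 * (t * t' - 1)) = 0.
  move/(congr1 (fun u => u * t')): K5 => /eqP; rewrite -subr_eq0 => /eqP <-.
  by rewrite /rho; field.
move/eqP: K6; rewrite !mulf_eq0 (negPf rho0) /= => /orP[/eqP x1|]; last first.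
  by rewrite subr_eq0 eq_sym => /eqP.
move/eqP: K5; rewrite !mulf_eq0 (negPf rho0) /= => /orP[/eqP x2|].
  by case/eqP: rho0; rewrite /rho x1 x2; ring.
by rewrite subr_eq0 => /eqP; apply: le1_of_inv.
Qed.

End SameFamily.

(** * Invariants that tell the families apart *)

Section Invariants.
Variable F : fieldType.
Implicit Types (P Q : liePair F).

(** Among the listed pairs this singles out the first, where the quotient by the center is a complex
    line. *)
Definition center_separating P := forall x y : pair_lie P, ~ central x ->
  [lie x, y] = 0 -> [lie x, pair_J P y] = 0 -> central y.

(** An elementwise form of the derived algebra having dimension at most 1. *)
Definition brackets_collinear P := forall x y u v : pair_lie P,
  [lie x, y] <> 0 -> exists k, [lie u, v] = k *: [lie x, y].

Definition has_isotropic P :=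
  exists2 x : pair_lie P, ~ central x & [lie x, pair_J P x] = 0.

(** This separates the fourth family, with its two isotropic lines, from the fifth pair, which has
    one. *)
Definition isotropics_commute P := forall x y : pair_lie P,
  [lie x, pair_J P x] = 0 -> [lie y, pair_J P y] = 0 -> [lie x, y] = 0.

Definition triple_brackets_collinear P := forall x y z u v w : pair_lie P,
  [lie x, [lie y, z]] <> 0 ->
  exists k, [lie u, [lie v, w]] = k *: [lie x, [lie y, z]].

Definition has_triple_bracket P :=
  exists x y z : pair_lie P, [lie x, [lie y, z]] <> 0.

Lemma holo_invariants P Q : holomorphically_isomorphic P Q ->
  [/\ center_separating Q -> center_separating P,
      brackets_collinear Q -> brackets_collinear P &
      has_isotropic P -> has_isotropic Q] /\
  [/\ isotropics_commute Q -> isotropics_commute P,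
      triple_brackets_collinear Q -> triple_brackets_collinear P &
      has_triple_bracket P -> has_triple_bracket Q].
Proof.
move=> [f [[h fK _] fl fJ]]; have fI := can_inj fK.
have f0 x : f x = 0 -> x = 0 by rewrite -{1}(linear0 f) => /fI.
have fc x : central (f x) -> central x by move=> cx y; apply: f0; rewrite fl cx.
split; split.
- move=> HQ x y ncx xy xJy; apply/fc/(HQ (f x)).
  + by move=> /fc.
  + by rewrite -fl xy linear0.
  + by rewrite fJ -fl xJy linear0.
- move=> HQ x y u v xy0; have [|k kE] := HQ (f x) (f y) (f u) (f v).
    by rewrite -fl => /f0.
  by exists k; apply: fI; rewrite linearZ /= !fl.
- move=> [x ncx xx]; exists (f x); first by move=> /fc.
  by rewrite fJ -fl xx linear0.
- move=> HQ x y xx yy; apply: f0; rewrite fl; apply: HQ;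
    by rewrite fJ -fl ?xx ?yy linear0.
- move=> HQ x y z u v w xyz.
  have [|k kE] := HQ (f x) (f y) (f z) (f u) (f v) (f w).
    by rewrite -!fl => /f0.
  by exists k; apply: fI; rewrite linearZ /= !fl.
- by move=> [x [y [z xyz]]]; exists (f x), (f y), (f z); rewrite -!fl => /f0.
Qed.

End Invariants.

Section Listed_invariants.
Variable R : realFieldType.
Implicit Types (l : label R).

(** The values of the invariants are tabulated as booleans, so that labels from different families
    are told apart by computation. *)
Definition center_separatingb l := if l is L1 then true else false.
Definition brackets_collinearb l := match l with L1 | L2 _ => true | _ => false end.
Definition has_isotropicb l :=
  match l with L1 | L3 _ => false | L2 b => b | _ => true end.
Definition isotropics_commuteb l :=
  match l with L2 b => ~~ b | L4 _ => false | _ => true end.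
Definition triple_brackets_collinearb l := if l is L7 _ then false else true.
Definition has_triple_bracketb l := match l with L6 | L7 _ => true | _ => false end.

Ltac brk tbl jtbl :=
  rewrite /lie_br /= ?tbl ?crdE ?jtbl ?crdE ?tbl ?crdE ?crd_e //=; try (split; ring).

Ltac nonzero k tbl :=
  let H := fresh "H" in
  move=> H; move/(congr1 (fun v => crd v k)): H;
  rewrite /lie_br /= !tbl ?crdE ?crd_e //= ?tbl ?crdE ?crd_e //=; clear; move=> ?; lra.

Lemma scale_collinear (V : lmodType R) (w : V) c d : c *: w <> 0 ->
  exists k, d *: w = k *: (c *: w).
Proof.
move=> cw; have c0 : c != 0 by apply/eqP => c0; apply: cw; rewrite c0 scale0r.
by exists (d / c); rewrite scalerA divfK.
Qed.

Lemma has_isotropicP l :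
  reflect (has_isotropic (listed_pair l)) (has_isotropicb l).
Proof.
case: l => [|[]|s|t| | |t] /=; constructor.
- move=> [x ncx xx]; apply: ncx => y.
  have := congr1 (fun v => crd v 6) xx.
  rewrite /lie_br /= !T1_crd !J1_crd crd0 => E.
  have /sqr_sum_eq0[x1 x2] : crd x 1 ^+ 2 + crd x 2 ^+ 2 = 0 by rewrite -[RHS]E; ring.
  by apply: crdP6; rewrite !T1_crd ?x1 ?x2 !crd0; split; ring.
- exists (e 1 + e 3); first by move=> /(_ (e 2)); nonzero 6%N T2_crd.
  by apply: crdP6; brk T2_crd J2_crd.
- move=> [x ncx xx]; apply: ncx => y.
  have := congr1 (fun v => crd v 6) xx.
  rewrite /lie_br /= !T2_crd !J2_crd crd0 => E.
  have /eqP : (crd x 1 ^+ 2 + crd x 2 ^+ 2) + (crd x 3 ^+ 2 + crd x 4 ^+ 2) = 0.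
    by rewrite -[RHS]E; ring.
  rewrite paddr_eq0 ?addr_ge0 ?sqr_ge0 //.
  move=> /andP[/eqP /sqr_sum_eq0[x1 x2] /eqP /sqr_sum_eq0[x3 x4]].
  by apply: crdP6; rewrite !T2_crd ?x1 ?x2 ?x3 ?x4 !crd0; split; ring.
- move=> [x ncx xx]; apply: ncx => y.
  have := congr1 (fun v => crd v 6) xx; have := congr1 (fun v => crd v 5) xx.
  rewrite /lie_br /= !T3_crd !J3_crd !crd0 => E E'.
  have /sqr_sum_eq0[x1 x2] : crd x 1 ^+ 2 + crd x 2 ^+ 2 = 0 by rewrite -[RHS]E; ring.
  have /sqr_sum_eq0[x3 x4] : crd x 3 ^+ 2 + crd x 4 ^+ 2 = 0 by rewrite -[RHS]E'; ring.
  by apply: crdP6; rewrite !T3_crd ?x1 ?x2 ?x3 ?x4 !crd0; split; ring.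
- exists (e 1 + e 4); first by move=> /(_ (e 3)); nonzero 5%N T4_crd.
  by apply: crdP6; brk T4_crd J4_crd.
- exists (e 4); first by move=> /(_ (e 1)); nonzero 6%N T5_crd.
  by apply: crdP6; brk T5_crd J5_crd.
- exists (e 4); first by move=> /(_ (e 1)); nonzero 6%N T6_crd.
  by apply: crdP6; brk T6_crd J6_crd.
- exists (e 3); first by move=> /(_ (e 1)); nonzero 5%N T7_crd.
  by apply: crdP6; brk T7_crd J7_crd.
Qed.

Lemma center_separatingP l :
  reflect (center_separating (listed_pair l)) (center_separatingb l).
Proof.
(* A noncentral isotropic x violates the property with y = x. *)
have noniso l' : has_isotropic (listed_pair l') -> ~ center_separating (listed_pair l').
  by move=> [x ncx xx] sep; apply: (ncx); apply: sep xx => //; exact: lie_alt.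
case: l => [|[]|s|t| | |t]; rewrite /center_separatingb ; constructor;
  try (by apply: noniso; apply/has_isotropicP).
- move=> x y ncx xy xJy z.
  have := congr1 (fun v => crd v 6) xy; have := congr1 (fun v => crd v 6) xJy.
  rewrite /lie_br /= !T1_crd !J1_crd !crd0 => E E'.
  have /eqP : (crd x 1 ^+ 2 + crd x 2 ^+ 2) * (crd y 1 ^+ 2 + crd y 2 ^+ 2) = 0.
    transitivity ((crd x 1 * crd y 1 - crd x 2 * - crd y 2) ^+ 2 +
     (crd x 1 * crd y 2 - crd x 2 * crd y 1) ^+ 2); first by ring.
    by rewrite E E' expr0n addr0.
  rewrite mulf_eq0 => /orP[] /eqP /sqr_sum_eq0[z1 z2].
    case: ncx => u.
    by apply: crdP6; rewrite !T1_crd ?z1 ?z2 !crd0; split; ring.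
  by apply: crdP6; rewrite !T1_crd ?z1 ?z2 !crd0; split; ring.
- move=> sep; have /(_ (e 4)) : central (e 3 : pair_lie (listed_pair (L2 R false))).
    apply: (sep (e 1)).
    + by move=> /(_ (e 2)); nonzero 6%N T2_crd.
    + by apply: crdP6; brk T2_crd J2_crd.
    + by apply: crdP6; brk T2_crd J2_crd.
  nonzero 6%N T2_crd.
- move=> sep; have /(_ (e 4)) : central (e 3 : pair_lie (listed_pair (L3 s))).
    apply: (sep (e 1)).
    + by move=> /(_ (e 2)); nonzero 5%N T3_crd.
    + by apply: crdP6; brk T3_crd J3_crd.
    + by apply: crdP6; brk T3_crd J3_crd.
  nonzero 6%N T3_crd.
Qed.

Lemma brackets_collinearP l :
  reflect (brackets_collinear (listed_pair l)) (brackets_collinearb l).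
Proof.
case: l => [|b|s|t| | |t] /=; constructor.
- have br x y : table_br (T1 R) x y = crd (table_br (T1 R) x y) 6 *: e 6.
    by apply: crdP6; rewrite !crdE !T1_crd !crd_e //=; split; ring.
  by move=> x y u v; rewrite /lie_br /= br (br u v); apply: scale_collinear.
- have br x y : table_br (T2 R) x y = crd (table_br (T2 R) x y) 6 *: e 6.
    by apply: crdP6; rewrite !crdE !T2_crd !crd_e //=; split; ring.
  by move=> x y u v; rewrite /lie_br /= br (br u v); apply: scale_collinear.
- move=> /(_ (e 1) (e 2) (e 3) (e 4))[|k]; first nonzero 5%N T3_crd.
  nonzero 6%N T3_crd.
- move=> /(_ (e 1) (e 3) (e 1) (e 4))[|k]; first nonzero 5%N T4_crd.
  nonzero 6%N T4_crd.
- move=> /(_ (e 1) (e 2) (e 1) (e 4))[|k]; first nonzero 5%N T5_crd.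
  nonzero 6%N T5_crd.
- move=> /(_ (e 1) (e 2) (e 1) (e 4))[|k]; first nonzero 5%N T6_crd.
  nonzero 6%N T6_crd.
- move=> /(_ (e 1) (e 2) (e 1) (e 4))[|k]; first nonzero 4%N T7_crd.
  nonzero 6%N T7_crd.
Qed.

Lemma isotropics_commuteP l :
  reflect (isotropics_commute (listed_pair l)) (isotropics_commuteb l).
Proof.
(* Without noncentral isotropic vectors every isotropic vector is central, so commutation is
   immediate. *)
have iso l' : ~ has_isotropic (listed_pair l') -> isotropics_commute (listed_pair l').
  move=> ni x y xx _; suff cx : central x by rewrite cx.
  by apply: contrapT => ncx; apply: ni; exists x.
case: l => [|[]|s|t| | |t]; rewrite /isotropics_commuteb ; constructor;
  try (by apply: iso => /has_isotropicP).
- move=> /(_ (e 1 + e 3) (e 1 + e 4)) H.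
  have {H} : [lie (e 1 + e 3 : n2 R), e 1 + e 4] = 0.
    by apply: H; apply: crdP6; brk T2_crd J2_crd.
  nonzero 6%N T2_crd.
- move=> /(_ (e 1 + e 4) (e 2 + e 3)) H.
  have {H} : [lie (e 1 + e 4 : n4 R), e 2 + e 3] = 0.
    by apply: H; apply: crdP6; brk T4_crd J4_crd.
  nonzero 5%N T4_crd.
(* One coordinate of [z, Jz] is a sum of two squares, which confines the isotropic vectors to a
   commutative subspace; the next two cases are alike. *)
- have iso5 (z : n5 R) : [lie z, J5 R z] = 0 -> crd z 1 = 0 /\ crd z 2 = 0.
    move=> zz; apply: sqr_sum_eq0; have := congr1 (fun v => crd v 5) zz.
    by rewrite /lie_br /= !T5_crd !J5_crd crd0 => E; rewrite -[RHS]E; ring.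
  move=> x y /iso5[x1 x2] /iso5[y1 y2].
  by apply: crdP6; rewrite /lie_br /= !T5_crd ?x1 ?x2 ?y1 ?y2 !crd0; split; ring.
- have iso6 (z : n6 R) : [lie z, J6 R z] = 0 -> crd z 1 = 0 /\ crd z 2 = 0.
    move=> zz; apply: sqr_sum_eq0; have := congr1 (fun v => crd v 5) zz.
    by rewrite /lie_br /= !T6_crd !J6_crd crd0 => E; rewrite -[RHS]E; ring.
  move=> x y /iso6[x1 x2] /iso6[y1 y2].
  by apply: crdP6; rewrite /lie_br /= !T6_crd ?x1 ?x2 ?y1 ?y2 !crd0; split; ring.
- have iso7 (z : n7 R) : [lie z, J7 t z] = 0 -> crd z 1 = 0 /\ crd z 2 = 0.
    move=> zz; apply: sqr_sum_eq0; have := congr1 (fun v => crd v 4) zz.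
    by rewrite /lie_br /= !T7_crd !J7_crd crd0 => E; rewrite -[RHS]E; ring.
  move=> x y /iso7[x1 x2] /iso7[y1 y2].
  by apply: crdP6; rewrite /lie_br /= !T7_crd ?x1 ?x2 ?y1 ?y2 !crd0; split; ring.
Qed.

Lemma has_triple_bracketP l :
  reflect (has_triple_bracket (listed_pair l)) (has_triple_bracketb l).
Proof.
case: l => [|b|s|t| | |t] /=; constructor.
- move=> [x [y [z]]]; apply.
  by apply: crdP6; rewrite /lie_br /= !T1_crd ?crd0; split; ring.
- move=> [x [y [z]]]; apply.
  by apply: crdP6; rewrite /lie_br /= !T2_crd ?crd0; split; ring.
- move=> [x [y [z]]]; apply.
  by apply: crdP6; rewrite /lie_br /= !T3_crd ?crd0; split; ring.
- move=> [x [y [z]]]; apply.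
  by apply: crdP6; rewrite /lie_br /= !T4_crd ?crd0; split; ring.
- move=> [x [y [z]]]; apply.
  by apply: crdP6; rewrite /lie_br /= !T5_crd ?crd0; split; ring.
- by exists (e 2), (e 1), (e 2); nonzero 6%N T6_crd.
- by exists (e 1), (e 1), (e 2); nonzero 6%N T7_crd.
Qed.

Lemma triple_brackets_collinearP l :
  reflect (triple_brackets_collinear (listed_pair l)) (triple_brackets_collinearb l).
Proof.
have two l' : ~ has_triple_bracket (listed_pair l') ->
    triple_brackets_collinear (listed_pair l').
  by move=> nt x y z u v w xyz; case: nt; exists x, y, z.
case: l => [|b|s|t| | |t]; rewrite /triple_brackets_collinearb ; constructor;
  try (by apply: two => /has_triple_bracketP).
- have br x y z : table_br (T6 R) x (table_br (T6 R) y z) =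
      crd (table_br (T6 R) x (table_br (T6 R) y z)) 6 *: e 6.
    by apply: crdP6; rewrite !crdE !T6_crd !crd_e //=; split; ring.
  by move=> x y z u v w; rewrite /lie_br /= br (br u v w); apply: scale_collinear.
- move=> /(_ (e 1) (e 1) (e 2) (e 2) (e 1) (e 2))[|k]; first nonzero 6%N T7_crd.
  nonzero 5%N T7_crd.
Qed.

Lemma holo_invariantsb l l' :
  holomorphically_isomorphic (listed_pair l) (listed_pair l') ->
  [/\ center_separatingb l = center_separatingb l',
      brackets_collinearb l = brackets_collinearb l' &
      has_isotropicb l = has_isotropicb l'] /\
  [/\ isotropics_commuteb l = isotropics_commuteb l',
      triple_brackets_collinearb l = triple_brackets_collinearb l' &
      has_triple_bracketb l = has_triple_bracketb l'].
Proof.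
move=> ll'; have [[B C D] [E F A]] := holo_invariants ll'.
have [[B' C' D'] [E' F' A']] := holo_invariants (holo_sym ll').
split; split.
- by apply/center_separatingP/center_separatingP.
- by apply/brackets_collinearP/brackets_collinearP.
- by apply/has_isotropicP/has_isotropicP.
- by apply/isotropics_commuteP/isotropics_commuteP.
- by apply/triple_brackets_collinearP/triple_brackets_collinearP.
- by apply/has_triple_bracketP/has_triple_bracketP.
Qed.

Lemma listed_pair_inj l l' : admissible l -> admissible l' ->
  holomorphically_isomorphic (listed_pair l) (listed_pair l') -> l = l'.
Proof.
move=> al al' ll'; have := holo_invariantsb ll'.
(* Different constructors disagree on some boolean, and the sign in [L2] is itself the value of
   [has_isotropicb]; the three real parameters remain. *)
case: l al ll' => [|b|s|t| | |t] /= al ll';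
  case: l' al' ll' => [|b'|s'|t'| | |t'] /= al' ll';
  move=> [[? ? ?] [? ? ?]] //; congr (_ _) => //.
- exact: listed_L3_inj.
- exact: listed_L4_inj.
- exact: listed_L7_inj.
Qed.

End Listed_invariants.

Theorem theorem3p4 (R : realType) :
  (forall (n : lieAlgebra R) (J : 'End(n)),
      \dim (fullv : {vspace n}) = 6%N ->
      lie_nilpotent n ->
      ~ lie_abelian n ->
      abelian_complex_structure J ->
      exists! l : label R,
        admissible l /\
        holomorphically_isomorphic (LiePair J) (listed_pair l)) /\
  (forall l l' : label R,
      admissible l -> admissible l' ->
      holomorphically_isomorphic (listed_pair l) (listed_pair l') ->
      l = l').
Proof.
split=> [n J dim6 nil nab acsJ|l l']; last exact: listed_pair_inj.
have [l al iso] := exists_listed_pair dim6 nil nab acsJ.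
exists l; split=> [//|l' [al' iso']]; apply: listed_pair_inj => //.
exact: holo_trans (holo_sym iso) iso'.
Qed.
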